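(* Let $G$ be a discrete group, let $A$ be a $C^*$-algebra, let $n\in\mathbb{N}$, and let $\alpha$ be a partial action of $G$ on $A$ with the $n$-decomposition property. Fix $\tau\in\mathcal{T}_n(G)$, and write $H=H_\tau$, $m=m_\tau$, $x_j=x_j^\tau$ and $\pi_j=\pi_j^\tau$. (1) For $h\in H$, $j,k=0,\ldots,m$, and $a\in A_{G\cdot\tau}^G$, we have $\pi_k(a)=\alpha_{x_k^{-1}hx_j}(\pi_j(a))$. (2) For $a\in A_\tau$, the following element belongs to $A_{G\cdot\tau}^G$: $$\varphi_\tau(a)=\frac{1}{|H|}\sum_{j=0}^m\sum_{h\in H}\alpha_{hx_j}^{-1}(a).$$ (3) The map $E_\tau\colon A_{G\cdot\tau}\to A_{G\cdot\tau}^G$ given by $$E_\tau(a)=\frac{1}{m+1}\sum_{j=0}^m\varphi_\tau\big(\alpha_{x_j}(\pi_j(a))\big)$$ for all $a\in A_{G\cdot\tau}$, is a faithful conditional expectation. (4) $E_\tau$ is independent of the elements $x_1,\ldots,x_m$. (5) For $g\in\tau^{-1}$, we have $E_{g\tau}=E_\tau$. It follows that the map $E=\bigoplus_{z\in\mathcal{O}_n(G)}E_{\tau_z}\colon A\to A^G$ is a canonical faithful conditional expectation, that is, $E$ is independent of the section $z\mapsto\tau_z$.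
   Context: Partial actions: a partial action $\alpha=((A_g)_{g\in G},(\alpha_g)_{g\in G})$ of a discrete group $G$ on a $C^*$-algebra $A$ consists of closed two-sided ideals $A_g$ of $A$ and $*$-isomorphisms $\alpha_g\colon A_{g^{-1}}\to A_g$ such that $A_1=A$, $\alpha_1=\mathrm{id}_A$, and $\alpha_{gh}$ extends $\alpha_g\circ\alpha_h$ wherever the composition is defined. Decomposition property: for $n\in\mathbb{N}=\{1,2,\ldots\}$ let $\mathcal{T}_n(G)=\{\tau\subseteq G\colon 1\in\tau,\ |\tau|=n\}$, and set $A_\tau=\bigcap_{g\in\tau}A_g$. $\alpha$ has the $n$-decomposition property if (a) $A=\overline{\sum_{\tau\in\mathcal{T}_n(G)}A_\tau}$, and (b) $A_\tau\cap A_g=\{0\}$ for all $\tau\in\mathcal{T}_n(G)$ and all $g\in G\setminus\tau$. Fixed point algebra: $A^G$ is the $C^*$-algebra of all $a\in A$ with $\alpha_{g^{-1}}(ab)=a\,\alpha_{g^{-1}}(b)$ for all $g\in G$ and $b\in A_g$. Orbit data: $G$ acts partially on $\mathcal{T}_n(G)$ by $\tau\mapsto g\tau$ for $\tau\ni g^{-1}$; $\mathcal{O}_n(G)$ is the orbit space, and $z\mapsto\tau_z$ is a fixed section of the quotient map $\mathcal{T}_n(G)\to\mathcal{O}_n(G)$. For $\tau\in\mathcal{T}_n(G)$ let $\tau^{-1}=\{g^{-1}\colon g\in\tau\}$, $H_\tau=\{h\in G\colon h\tau=\tau\}$ (a finite subgroup whose order divides $n$), $m_\tau=\frac{n}{|H_\tau|}-1$,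 and fix $x_0^\tau=1,x_1^\tau,\ldots,x_{m_\tau}^\tau\in G$ with $\tau=\bigsqcup_{j=0}^{m_\tau}H_\tau x_j^\tau$. Let $A_{G\cdot\tau}=\sum_{g\in\tau^{-1}}A_{g\tau}$. This is a $G$-invariant ideal (so $\alpha$ restricts to a partial action on it with domains $A_{G\cdot\tau}\cap A_g$, and $A_{G\cdot\tau}^G$ is its fixed point algebra), and it is the direct sum of the ideals $A_{(x_j^\tau)^{-1}\tau}$, $0\le j\le m_\tau$; $\pi_j^\tau\colon A_{G\cdot\tau}\to A_{(x_j^\tau)^{-1}\tau}$ denotes the projection. $A$ is equivariantly the ($c_0$-)direct sum of the ideals $A_{G\cdot\tau_z}$, $z\in\mathcal{O}_n(G)$, so that $A^G=\bigoplus_z A_{G\cdot\tau_z}^G$. *)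

(* Defs.v *)
From HB Require Import structures.
From mathcomp Require Import all_boot all_order all_algebra.
From mathcomp Require Import finmap complex.
From mathcomp Require Import boolp classical_sets functions cardinality fsbigop.
From mathcomp Require Import reals topology normedtype summability.

Set Implicit Arguments.
Unset Strict Implicit.
Unset Printing Implicit Defensive.
Import Order.TTheory GRing.Theory Num.Theory.
Import numFieldNormedType.Exports.
Local Open Scope classical_set_scope.
Local Open Scope ring_scope.

(* Not assumed unital, hence the product is not a [GRing] ring product.  The
   norm takes its values in R[i], as for any normed module over R[i]. *)
HB.mixin Record isCStarAlgebra (R : realType) A
    of CompleteNormedModule R[i] A := {
  cmul : A -> A -> A;
  cstar : A -> A;
  cmulA : associative cmul;
  cmulDl : left_distributive cmul +%R;
  cmulDr : right_distributive cmul +%R;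
  cmulZl : forall (c : R[i]) (a b : A), cmul (c *: a) b = c *: cmul a b;
  cmulZr : forall (c : R[i]) (a b : A), cmul a (c *: b) = c *: cmul a b;
  cstarK : involutive cstar;
  cstarD : {morph cstar : a b / a + b};
  cstarZ : forall (c : R[i]) (a : A), cstar (c *: a) = c^* *: cstar a;
  cstarM : forall a b : A, cstar (cmul a b) = cmul (cstar b) (cstar a);
  cnormM : forall a b : A, `|cmul a b| <= `|a| * `|b|;
  cnorm_star : forall a : A, `|cmul (cstar a) a| = `|a| ^+ 2
}.

#[short(type="cstarAlgType")]
HB.structure Definition CStarAlgebra (R : realType) :=
  {A of isCStarAlgebra R A & CompleteNormedModule R[i] A}.

Declare Scope cstar_scope.
Delimit Scope cstar_scope with CS.
Notation "a ** b" := (cmul a b)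
  (at level 40, left associativity) : cstar_scope.
Notation "a ^*" := (cstar a) : cstar_scope.
Local Open Scope cstar_scope.

Section CStarAlgebraTheory.
Context {R : realType} {A : cstarAlgType R}.
Implicit Types (I J B D : set A) (a b : A).

Definition closed_ideal I : Prop :=
  [/\ closed I, I 0,
      forall (c : R[i]) a b, I a -> I b -> I (c *: a + b),
      forall a b, I b -> I (a ** b) &
      forall a b, I a -> I (a ** b)].

Definition star_iso I J (f : A -> A) : Prop :=
  [/\ set_bij I J f,
      forall (c : R[i]) a b, I a -> I b -> f (c *: a + b) = c *: f a + f b,
      forall a b, I a -> I b -> f (a ** b) = f a ** f b &
      forall a, I a -> f (a ^*) = (f a) ^*].

Definition cstar_subalgebra B : Prop :=
  [/\ closed B, B 0,
      forall (c : R[i]) a b, B a -> B b -> B (c *: a + b),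
      forall a b, B a -> B b -> B (a ** b) &
      forall a, B a -> B (a ^*)].

(* Positive elements of the C*-algebra B. *)
Definition positives B : set A := [set b | exists2 c, B c & b = c ^* ** c].

(* E is a conditional expectation from the C*-algebra D onto its C*-subalgebra
   B: a positive contractive B-bimodule projection of D onto B.  Complete
   positivity follows from positivity and the bimodule property.  Only the
   values of E on D matter. *)
Record cond_expectation D B (E : A -> A) : Prop := CondExpectation {
  ce_dom : cstar_subalgebra D;
  ce_cod : cstar_subalgebra B;
  ce_sub : B `<=` D;
  ce_in : forall a, D a -> B (E a);
  ce_id : forall b, B b -> E b = b;
  ce_linear : forall (c : R[i]) a b,
    D a -> D b -> E (c *: a + b) = c *: E a + E b;
  ce_pos : forall a, positives D a -> positives B (E a);
  ce_contr : forall a, D a -> `|E a| <= `|a|;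
  ce_modl : forall b a, B b -> D a -> E (b ** a) = b ** E a;
  ce_modr : forall a b, D a -> B b -> E (a ** b) = E a ** b
}.

Definition faithful_cond_expectation D B (E : A -> A) : Prop :=
  cond_expectation D B E /\ (forall a, positives D a -> E a = 0 -> a = 0).

(* Algebraic (not closed) sum of the family of subspaces X i, i in S. *)
Definition subspace_sum (K : choiceType) (S : set K) (X : K -> set A) : set A :=
  [set a | exists (F : {fset K}) (f : K -> A),
     (forall i, i \in F -> S i /\ X i (f i)) /\ a = \sum_(i <- F) f i].

End CStarAlgebraTheory.

(* [pact g] is a total function, but only its values on [pdom g^-1] matter. *)
Record partialAction (R : realType) (G : groupType) (A : cstarAlgType R) :=
  PartialAction {
  pdom : G -> set A;
  pact :> G -> A -> A;
  pdom_ideal : forall g, closed_ideal (pdom g);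
  pact_iso : forall g, star_iso (pdom (g^-1)%g) (pdom g) (pact g);
  pdom1 : pdom 1%g = setT;
  pact1 : forall a, pact 1%g a = a;
  pactM : forall g h a, pdom (h^-1)%g a -> pdom (g^-1)%g (pact h a) ->
    pdom ((g * h)^-1)%g a /\ pact (g * h)%g a = pact g (pact h a)
}.

Section Tuples.
Context {G : groupType}.
Implicit Types (g h : G) (t : {fset G}).

(* T_n(G) *)
Definition tuples (n : nat) : set {fset G} :=
  [set t : {fset G} | (1%g \in t) /\ #|` t| = n].

Definition ltrans g t : {fset G} := [fset (g * x)%g | x in t]%fset.

(* t^-1 *)
Definition invset t : set G := [set (g^-1)%g | g in [set` t]].

(* H_t *)
Definition lstab t : set G := [set h | ltrans h t = t].

Definition lstab_card t : nat := #|` fset_set (lstab t)|.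

(* m_t *)
Definition mt (n : nat) t : nat := (n %/ lstab_card t).-1.

(* x = (x_0 = 1, x_1, ..., x_m) with t the disjoint union of the H_t x_j. *)
Definition coset_reps (n : nat) t (x : 'I_(mt n t).+1 -> G) : Prop :=
  [/\ x ord0 = 1%g,
      [set` t] = \bigcup_j [set (h * x j)%g | h in lstab t] &
      trivIset setT (fun j => [set (h * x j)%g | h in lstab t])].

(* Orbit of t under the partial action of G on the subsets containing 1, in
   which g acts on t precisely when g^-1 \in t. *)
Definition orb t : set {fset G} := [set ltrans g t | g in invset t].

(* O_n(G), as the set of equivalence classes *)
Definition orbit_space (n : nat) : set (set {fset G}) :=
  [set orb t | t in tuples n].

Definition orbit_section (n : nat) (s : orbit_space n -> {fset G}) : Prop :=
  forall z, tuples n (s z) /\ orb (s z) = val z.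

End Tuples.

Section Decomposition.
Context {R : realType} {G : groupType} {A : cstarAlgType R}.
Variable alpha : partialAction G A.
Implicit Types (g h : G) (t : {fset G}) (a b : A).

(* A_t *)
Definition tideal t : set A := \bigcap_(g in [set` t]) pdom alpha g.

Definition decomposition_property (n : nat) : Prop :=
  closure (subspace_sum (tuples n) tideal) = setT /\
  (forall t g, tuples n t -> g \notin t ->
     tideal t `&` pdom alpha g = [set 0]).

(* Inverse of the bijection alpha_g : A_(g^-1) -> A_g. *)
Definition pact_inv g : A -> A :=
  'pinv_(fun=> 0) (pdom alpha (g^-1)%g) (alpha g).

(* Fixed point algebra of the restriction of alpha to the invariant ideal I,
   that is, of the partial action with domains I `&` A_g. *)
Definition fixed_algebra (I : set A) : set A :=
  [set a | I a /\ forall g b, (I `&` pdom alpha g) b ->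
     alpha (g^-1)%g (a ** b) = a ** alpha (g^-1)%g b].

(* A_(G.t) *)
Definition orbit_ideal t : set A :=
  subspace_sum (invset t) (fun g => tideal (ltrans g t)).

(* A_(G.t)^G *)
Definition orbit_fixed t : set A := fixed_algebra (orbit_ideal t).

Section Expectation.
Variables (n : nat) (t : {fset G}) (x : 'I_(mt n t).+1 -> G).

(* Projection of the direct sum A_(G.t) of the ideals A_(x_i^-1 t), i <= m,
   onto its j-th summand. *)
Definition proj_comp (j : 'I_(mt n t).+1) a : A :=
  xget 0 [set b | exists f : 'I_(mt n t).+1 -> A,
    [/\ forall i, tideal (ltrans (x i)^-1%g t) (f i),
        a = \sum_i f i & b = f j]].

Definition phi a : A :=
  (lstab_card t)%:R^-1 *:
    \sum_j \sum_(h \in lstab t) pact_inv (h * x j)%g a.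

Definition orbit_expectation a : A :=
  (mt n t).+1%:R^-1 *: \sum_j phi (alpha (x j) (proj_comp j a)).

End Expectation.

Section GlobalExpectation.
Unset Implicit Arguments.
Variables (n : nat) (x : forall t : {fset G}, 'I_(mt n t).+1 -> G).
Set Implicit Arguments.
Variable s : orbit_space (G := G) n -> {fset G}.

(* a is the sum of the elements f z of the ideals A_(G.t_z): unconditional
   norm convergence, which amounts to f being in the c_0-direct sum. *)
Definition c0_decomposition (f : orbit_space n -> A) a : Prop :=
  (forall z, orbit_ideal (s z) (f z)) /\ partial_sum f @ totally --> a.

Definition c0_comp (z : orbit_space n) a : A :=
  xget 0 [set b | exists2 f, c0_decomposition f a & b = f z].

(* The direct sum over z of the maps E_(t_z) *)
Definition global_expectation a : A :=
  lim (partial_sum (fun z => orbit_expectation (x (s z)) (c0_comp z a))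
         @ totally).

End GlobalExpectation.
End Decomposition.

(* Main.v *)
Require Import Defs.
From HB Require Import structures.
From mathcomp Require Import all_boot all_order all_algebra.
From mathcomp Require Import finmap complex.
From mathcomp Require Import boolp classical_sets functions cardinality fsbigop.
From mathcomp Require Import reals topology normedtype sequences summability.
From mathcomp Require Import ring lra.

Import Order.TTheory GRing.Theory Num.Theory.
Import numFieldNormedType.Exports.
Local Open Scope classical_set_scope.
Local Open Scope ring_scope.
Local Open Scope cstar_scope.
Set Implicit Arguments.
Unset Strict Implicit.
Unset Printing Implicit Defensive.

(** Distinct tuples s and t have A_s and A_t orthogonal, since A_t meets A_g in
    0 for any g in s but not in t.  As the sum of all of the A_t is dense, A is
    their c_0-direct sum: every a has a component a_t = tcomp t a in every A_t,
    taking components is a contractive *-homomorphism, and the norm of a is the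
    supremum of the norms of the a_t (norm_le_tcomp).  An identity in A can thus
    be checked one component at a time (tcomp_ext).

    For g in t the map alpha_g carries A_(g^-1 t) onto A_t.  In these
    coordinates, a is a fixed point if and only if
      alpha_g (a_(g^-1 t)) = a_t    for all t and all g in t
    (fixed_supportedE), and there is an obvious conditional expectation onto the
    fixed points: let E a be the element with the components
      (E a)_t = (1 / n) sum_(g in t) alpha_g (a_(g^-1 t)).
    This is average below.  The ideal A_(G.t) consists of the elements supported
    on the orbit of t (orbit_idealE).  Writing the elements of t as h x_j, one
    finds that phi_t is (n / |H|) E on A_t, that E is unchanged when an element
    is moved by alpha_(x_j), and therefore that E_t is the restriction of E to
    A_(G.t) (orbit_expectationE).  Likewise the c_0-sum of the E_(t_z) is E
    (global_expectationE).  As the formula for E mentions neither representatives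
    nor sections, all of the claims about independence follow at once, and what
    remains is that E is a faithful conditional expectation on the elements
    supported on any invariant family of tuples
    (faithful_cond_expectation_average).

    The algebraic properties of E are read off from the components.  Positivity
    asks that E (c* c) be d* d with d a fixed point.  It is a limit of sums of
    elements of the form u* u, so one needs that such sums have a self-adjoint
    square root in every closed subalgebra that contains them, and, for
    faithfulness, that such a sum vanishes only if its terms do.  One also needs
    that closed ideals are self-adjoint and that the alpha_g are isometric.  All
    of this is derived without spectral theory from two facts: commuting
    self-adjoint x and y satisfy |x|^2 <= |x^2 + y^2| (norm_sqr_le_sqrD), and
    1 - sqrt (1 - c) exists when c is self-adjoint with |c| <= 1
    (one_sub_sqrt).  As A need not have a unit, positivity is studied in its
    unitization. *)

(** * Scalars and approximation *)

Section ComplexScalars.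
Context {R : realType}.

Lemma pos_complexP (e : R[i]) : 0 < e -> exists2 r : R, 0 < r & e = (r%:C)%C.
Proof.
move=> e0; have /complex_realP[r er] := gtr0_real e0.
by exists r; rewrite // -ltcR -er.
Qed.

Lemma invn_small (e : R[i]) : 0 < e ->
  exists N, forall k, (N <= k)%N -> (k.+1%:R)^-1 <= e.
Proof.
move=> /pos_complexP[r r0 ->]; exists (Num.bound r^-1) => k Nk.
rewrite -(rmorph_nat (real_complex R)) -fmorphV lecR.
rewrite invf_ple ?posrE// (le_trans (ltW (archi_boundP _))) ?invr_ge0 ?ltW//.
by rewrite ltr_nat ltnS.
Qed.

Lemma le_of_le_eps (x y : R[i]) : x \is Num.real -> y \is Num.real ->
  (forall e, 0 < e -> x <= y + e) -> x <= y.
Proof.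
move=> rx ry H; rewrite real_leNgt//; apply/negP => yx.
have := H ((x - y) / 2); rewrite divr_gt0 ?subr_gt0// => /(_ isT).
rewrite -lerBlDl ler_pdivlMr// ger_pMr ?subr_gt0//.
by rewrite (ler_nat _ 2 1).
Qed.

End ComplexScalars.

Section Sequences.
Context {R : realType} {V : completeNormedModType R[i]}.
Implicit Types (a b : V) (S : set V).

Lemma norm_small_eq0 a : (forall e : R[i], 0 < e -> `|a| <= e) -> a = 0.
Proof.
move=> H; apply/eqP; rewrite -normr_eq0; apply/negPn/negP => a0.
have n0 : 0 < `|a| by rewrite lt_def a0 normr_ge0.
have /H : 0 < `|a| / 2 by rewrite divr_gt0.
by rewrite ler_pdivlMr// ger_pMr// (ler_nat _ 2 1).
Qed.

Lemma approx_closed S a : closed S ->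
  (forall e : R[i], 0 < e -> exists2 s, S s & `|a - s| <= e) -> S a.
Proof.
move=> cS H; apply: cS => B /nbhs_ballP[e /= e0 eB].
have /H[s Ss sa] : 0 < e / 2 by rewrite divr_gt0.
exists s; split=> //; apply: eB; rewrite -ball_normE /=.
by apply: le_lt_trans sa _; rewrite ltr_pdivrMr// ltr_pMr// (ltr_nat _ 1 2).
Qed.

Lemma closure_approx S a : closure S a ->
  forall e : R[i], 0 < e -> exists2 s, S s & `|a - s| <= e.
Proof.
move=> cSa e e0; have [s [Ss]] := cSa _ (nbhsx_ballx a e e0).
by rewrite -ball_normE /= => /ltW; exists s.
Qed.

Lemma closed_of_approx S :
  (forall a, (forall e : R[i], 0 < e -> exists2 s, S s & `|a - s| <= e) -> S a) ->
  closed S.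
Proof. by move=> H a /closure_approx; exact: H. Qed.

Lemma cauchy_seq_cvg (u : nat -> V) :
  (forall e : R[i], 0 < e -> exists N, forall m k, (N <= m)%N -> (N <= k)%N ->
     `|u m - u k| <= e) ->
  exists l, forall e : R[i], 0 < e -> exists N, forall k, (N <= k)%N ->
     `|l - u k| <= e.
Proof.
move=> H; have : cvg (u @ \oo).
  apply/cauchy_cvgP/cauchy_exP => e e0.
  have [N HN] := H (e / 2) (divr_gt0 e0 (ltr0n _ 2)).
  exists (u N); exists N => // k /= Nk; rewrite -ball_normE /=.
  apply: le_lt_trans (HN _ _ _ Nk) _ => //.
  by rewrite ltr_pdivrMr// ltr_pMr// (ltr_nat _ 1 2).
move=> /cvg_ex[l /cvgrPdist_le ul]; exists l => e e0.
by have [N _ HN] := ul e e0; exists N.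
Qed.

End Sequences.

(** * Norms and involution in a C*-algebra *)
Section CStarBasics.
Context {R : realType} {A : cstarAlgType R}.
Implicit Types (a b c x y : A) (C : set A).

Lemma cmul0l a : 0 ** a = 0.
Proof. by apply: (addrI (0 ** a)); rewrite -cmulDl !addr0. Qed.

Lemma cmul0r a : a ** 0 = 0.
Proof. by apply: (addrI (a ** 0)); rewrite -cmulDr !addr0. Qed.

Lemma cmulNl a b : (- a) ** b = - (a ** b).
Proof. by apply: (addrI (a ** b)); rewrite -cmulDl !subrr cmul0l. Qed.

Lemma cmulNr a b : a ** (- b) = - (a ** b).
Proof. by apply: (addrI (a ** b)); rewrite -cmulDr !subrr cmul0r. Qed.

Lemma cmulBl a b c : (a - b) ** c = a ** c - b ** c.
Proof. by rewrite cmulDl cmulNl. Qed.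

Lemma cmulBr a b c : a ** (b - c) = a ** b - a ** c.
Proof. by rewrite cmulDr cmulNr. Qed.

Lemma cstar0 : cstar 0 = 0 :> A.
Proof. by apply: (addrI (cstar 0)); rewrite -cstarD !addr0. Qed.

Lemma cstarN a : cstar (- a) = - cstar a.
Proof. by apply: (addrI (cstar a)); rewrite -cstarD !subrr cstar0. Qed.

Lemma cstarB a b : cstar (a - b) = cstar a - cstar b.
Proof. by rewrite cstarD cstarN. Qed.

Lemma cmul_suml (I : Type) (r : seq I) (P : pred I) (F : I -> A) b :
  (\sum_(i <- r | P i) F i) ** b = \sum_(i <- r | P i) (F i ** b).
Proof. by apply: (big_morph (fun a => a ** b)); [move=> ? ?; exact: cmulDl|exact: cmul0l]. Qed.

Lemma cmul_sumr (I : Type) (r : seq I) (P : pred I) (F : I -> A) b :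
  b ** (\sum_(i <- r | P i) F i) = \sum_(i <- r | P i) (b ** F i).
Proof. by apply: (big_morph (cmul b)); [move=> ? ?; exact: cmulDr|exact: cmul0r]. Qed.

Lemma cstar_sum (I : Type) (r : seq I) (P : pred I) (F : I -> A) :
  cstar (\sum_(i <- r | P i) F i) = \sum_(i <- r | P i) cstar (F i).
Proof. by apply: big_morph; [exact: cstarD|exact: cstar0]. Qed.

Lemma cnorm_cstar a : `|cstar a| = `|a|.
Proof.
suff le b : `|b| <= `|cstar b| by apply/eqP; rewrite eq_le le -{2}(cstarK a) le.
have [->|b0] := eqVneq b 0; first by rewrite cstar0.
have n0 : 0 < `|b| by rewrite normr_gt0.
by rewrite -(ler_pM2r n0) -expr2 -cnorm_star cnormM.
Qed.

Lemma cstar_mul_eq0 a : cstar a ** a = 0 -> a = 0.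
Proof.
by move=> a0; apply/eqP; rewrite -normr_eq0 -sqrf_eq0 -cnorm_star a0 normr0.
Qed.

Lemma mul_cstar_eq0 a : a ** cstar a = 0 -> a = 0.
Proof. by move=> a0; rewrite -[a]cstarK (@cstar_mul_eq0 (cstar a)) ?cstarK ?cstar0. Qed.

Lemma cnorm_star_r a : `|a ** cstar a| = `|a| ^+ 2.
Proof. by rewrite -{1}(cstarK a) cnorm_star cnorm_cstar. Qed.

Lemma sa_sqr_eq0 a : cstar a = a -> a ** a = 0 -> a = 0.
Proof. by move=> sa aa; apply: cstar_mul_eq0; rewrite sa. Qed.

Lemma cnorm_sa_sqr a : cstar a = a -> `|a ** a| = `|a| ^+ 2.
Proof. by move=> {1}<-; exact: cnorm_star. Qed.

Lemma cstar_sa_mul a : cstar (cstar a ** a) = cstar a ** a.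
Proof. by rewrite cstarM cstarK. Qed.

Lemma cstarZnr (r : R[i]) a : r \is Num.real -> cstar (r *: a) = r *: cstar a.
Proof. by move=> rr; rewrite cstarZ conj_Creal. Qed.

Lemma conj_imaginary : ('i%C : R[i])^*%R = - 'i%C.
Proof. exact: conjCi. Qed.

(** The left side is at most |z|^2 for z = x + i y, of which x is the real part,
    and |z|^2 is the norm of z* z, which is x^2 + y^2 as x and y commute. *)
Lemma norm_sqr_le_sqrD x y : cstar x = x -> cstar y = y -> x ** y = y ** x ->
  `|x| ^+ 2 <= `|x ** x + y ** y|.
Proof.
move=> sx sy xy; pose z := x + 'i%C *: y.
have zs : cstar z = x - 'i%C *: y.
  by rewrite cstarD cstarZ sx sy conj_imaginary scaleNr.
have -> : x ** x + y ** y = cstar z ** z.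
  rewrite zs cmulBl !cmulDr !cmulZl !cmulZr xy scalerA -expr2 sqr_i scaleN1r.
  by rewrite opprD opprK addrA addrK.
rewrite cnorm_star lerXn2r ?nnegrE//.
have -> : x = 2^-1 *: (z + cstar z).
  rewrite zs addrACA subrr addr0 -mulr2n -[x *+ 2]scaler_nat scalerA mulVf.
    by rewrite scale1r.
  by rewrite pnatr_eq0.
rewrite normrZ normfV normr_nat ler_pdivrMl//.
by rewrite (le_trans (ler_normD _ _))// cnorm_cstar mulr_natl mulr2n.
Qed.

(** Closure under the involution is left out, so that commutants of single
    elements and closed ideals are instances. *)
Definition closed_subalgebra C :=
  [/\ closed C, C 0,
      forall (c : R[i]) a b, C a -> C b -> C (c *: a + b) &
      forall a b, C a -> C b -> C (a ** b)].

Lemma csubalgD C a b : closed_subalgebra C -> C a -> C b -> C (a + b).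
Proof. by case=> _ _ lin _ Ca Cb; rewrite -[a]scale1r; exact: lin. Qed.

Lemma csubalgZ C (c : R[i]) a : closed_subalgebra C -> C a -> C (c *: a).
Proof. by case=> _ C0 lin _ Ca; rewrite -[_ *: _]addr0; exact: lin. Qed.

Lemma csubalgN C a : closed_subalgebra C -> C a -> C (- a).
Proof. by move=> hC Ca; rewrite -scaleN1r; exact: csubalgZ. Qed.

Lemma csubalgB C a b : closed_subalgebra C -> C a -> C b -> C (a - b).
Proof. by move=> hC Ca Cb; apply: csubalgD => //; exact: csubalgN. Qed.

Lemma closed_eq_bounded (f g : A -> A) (M : R[i]) :
  0 < M ->
  (forall a b, `|f a - f b| <= M * `|a - b|) ->
  (forall a b, `|g a - g b| <= M * `|a - b|) ->
  closed [set a | f a = g a].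
Proof.
move=> M0 hf hg; apply: closed_of_approx => a H /=.
apply/eqP; rewrite -subr_eq0; apply/eqP/norm_small_eq0 => e e0.
have [s /= fgs sa] := H (e / (M + M)) (divr_gt0 e0 (addr_gt0 M0 M0)).
rewrite -(subrKA (f s)) {2}fgs; apply: le_trans (ler_normD _ _) _.
rewrite -[e](@divfK _ (M + M)) ?gt_eqF ?addr_gt0// mulrDr !(mulrC (e / _)).
apply: lerD; [apply: le_trans (hf _ _) _|rewrite distrC; apply: le_trans (hg _ _) _].
  by rewrite ler_pM2l.
by rewrite ler_pM2l.
Qed.

(** An element produced by a limit of polynomials in b thus commutes with
    whatever commutes with b. *)
Lemma commutant_closed_subalgebra a :
  closed_subalgebra [set b | a ** b = b ** a].
Proof.
have M0 : 0 < `|a| + 1 by rewrite ltr_wpDl.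
split => /=.
- apply: (closed_eq_bounded M0) => b c; rewrite -?cmulBr -?cmulBl.
    by apply: le_trans (cnormM _ _) _; rewrite ler_wpM2r// lerDl.
  by apply: le_trans (cnormM _ _) _; rewrite mulrC ler_wpM2r// lerDl.
- by rewrite cmul0l cmul0r.
- by move=> c b d ab ad; rewrite cmulDr cmulDl cmulZl cmulZr ab ad.
- by move=> b d ab ad; rewrite cmulA ab -cmulA ad cmulA.
Qed.

End CStarBasics.

(** * Square roots by iteration *)
Section Majorant.
Variable R : realType.

(** The iteration of sqrt_iter for c = 1.  Its increments dominate those of
    sqrt_iter, so that convergence reduces to that of a bounded monotone
    sequence of reals. *)
Fixpoint sqrt_majorant (k : nat) : R :=
  if k is k'.+1 then (1 + sqrt_majorant k' ^+ 2) / 2 else 0.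

Lemma sqrt_majorant_bounds k :
  0 <= sqrt_majorant k /\ sqrt_majorant k <= 1.
Proof. by elim: k => [|k [r0 r1]] /=; split; nra. Qed.

Lemma sqrt_majorant_homo : {homo sqrt_majorant : k l / (k <= l)%N >-> k <= l}.
Proof.
apply: homo_leq => [//|y x z|k]; first exact: le_trans.
have [r0 r1] := sqrt_majorant_bounds k; rewrite /=; nra.
Qed.

Lemma sqrt_majorant_cauchy (e : R) : 0 < e -> exists N, forall k l,
  (N <= k)%N -> (k <= l)%N -> sqrt_majorant l - sqrt_majorant k <= e.
Proof.
move=> e0; have cr : cvg (sqrt_majorant @ \oo).
  apply: nondecreasing_is_cvgn; first exact: sqrt_majorant_homo.
  by exists 1 => _ [k _ <-]; have [] := sqrt_majorant_bounds k.
have /cvgrPdist_le /(_ e e0)[N _ HN] := cr.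
exists N => k l Nk kl; have := HN k Nk => /=.
have := nondecreasing_cvgn_le sqrt_majorant_homo cr l.
by move=> h1; rewrite ler_norml => /andP[_ h2]; lra.
Qed.

End Majorant.

Section SquareRoot.
Context {R : realType} {A : cstarAlgType R}.
Implicit Types (a b c x y : A) (C : set A).

(** A fixed point y satisfies 2 y - y^2 = c, that is, (1 - y)^2 = 1 - c. *)
Fixpoint sqrt_iter c (k : nat) : A :=
  if k is k'.+1 then 2^-1 *: (c + sqrt_iter c k' ** sqrt_iter c k') else 0.

Let r := sqrt_majorant R.

Lemma sqr_subE x y : x ** x - y ** y = (x - y) ** x + y ** (x - y).
Proof. by rewrite cmulBl cmulBr addrA subrK. Qed.

Lemma sqrt_iter_bound c k : `|c| <= 1 -> `|sqrt_iter c k| <= ((r k)%:C)%C.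
Proof.
move=> c1; elim: k => [|k IH] /=; first by rewrite normr0.
rewrite normrZ normfV normr_nat ler_pdivrMl//.
apply: le_trans (ler_normD _ _) _.
have -> : 2 * (((1 + r k ^+ 2) / 2)%:C)%C = 1 + ((r k)%:C)%C ^+ 2 :> R[i].
  rewrite -(rmorph_nat (real_complex R)) -rmorphM mulrC divfK ?pnatr_eq0//.
  by rewrite rmorphD rmorph1 rmorphXn.
rewrite lerD// (le_trans (cnormM _ _))// -expr2 lerXn2r ?nnegrE//.
exact: le_trans IH.
Qed.

(** The difference of squares splits without commutativity, so the increments
    of the iteration obey the same recursion as those of the majorant. *)
Lemma sqrt_iter_step c k : `|c| <= 1 ->
  `|sqrt_iter c k.+1 - sqrt_iter c k| <= ((r k.+1 - r k)%:C)%C.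
Proof.
move=> c1; elim: k => [|k IH].
  rewrite /= cmul0l addr0 !subr0 normrZ normfV normr_nat expr0n addr0 mul1r.
  by rewrite fmorphV rmorph_nat ler_piMr ?invr_ge0.
have -> : sqrt_iter c k.+2 - sqrt_iter c k.+1 =
    2^-1 *: (sqrt_iter c k.+1 ** sqrt_iter c k.+1 - sqrt_iter c k ** sqrt_iter c k).
  by rewrite -scalerBr opprD addrACA subrr add0r.
rewrite sqr_subE normrZ normfV normr_nat ler_pdivrMl//.
have -> : 2 * ((r k.+2 - r k.+1)%:C)%C =
   ((r k.+1 - r k)%:C)%C * ((r k.+1)%:C)%C + ((r k)%:C)%C * ((r k.+1 - r k)%:C)%C :> R[i].
  rewrite -(rmorph_nat (real_complex R)) -!rmorphM -rmorphD.
  by congr (_%:C)%C; rewrite [r k.+2]/= [r k.+1]/= -/r; lra.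
apply: le_trans (ler_normD _ _) _; apply: lerD; apply: le_trans (cnormM _ _) _.
  by apply: ler_pM => //; exact: sqrt_iter_bound.
by apply: ler_pM => //; exact: sqrt_iter_bound.
Qed.

Lemma sqrt_iter_dist c k l : `|c| <= 1 -> (k <= l)%N ->
  `|sqrt_iter c l - sqrt_iter c k| <= ((r l - r k)%:C)%C.
Proof.
move=> c1 /subnKC <-; elim: (l - k)%N => [|d IH].
  by rewrite addn0 !subrr normr0.
rewrite addnS -(subrKA (sqrt_iter c (k + d))) -(subrKA (r (k + d))).
by rewrite rmorphD (le_trans (ler_normD _ _))// lerD// sqrt_iter_step.
Qed.

Lemma sqrt_iter_mem c k C : closed_subalgebra C -> C c -> C (sqrt_iter c k).
Proof.
move=> hC Cc; elim: k => [|k IH] /=; first by case: hC.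
apply: csubalgZ => //; apply: csubalgD => //.
by case: hC => _ _ _; apply.
Qed.

Lemma sqrt_iter_sa c k : cstar c = c -> cstar (sqrt_iter c k) = sqrt_iter c k.
Proof.
move=> sc; elim: k => [|k IH] /=; first exact: cstar0.
by rewrite cstarZnr ?rpredV ?realn// cstarD cstarM IH sc.
Qed.

(** With a unit e adjoined, e - y is the square root of e - c; the statement
    avoids the unit, so that y stays in any ideal that contains c. *)
Lemma one_sub_sqrt c : cstar c = c -> `|c| <= 1 -> exists y,
  [/\ cstar y = y, y + y - y ** y = c, `|y| <= 1 &
      forall C, closed_subalgebra C -> C c -> C y].
Proof.
move=> sc c1.
have [|y Hy] := @cauchy_seq_cvg _ _ (sqrt_iter c).
  move=> _ /pos_complexP[e e0 ->]; have [N HN] := sqrt_majorant_cauchy e0.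
  exists N => m k; wlog mk : m k / (k <= m)%N.
    move=> H Nm Nk; have /orP[km|mk] := leq_total k m; first exact: H.
    by rewrite distrC; exact: H.
  by move=> Nm Nk; rewrite (le_trans (sqrt_iter_dist c1 mk))// lecR HN.
have yapp (P : set A) : closed P -> (forall k, P (sqrt_iter c k)) -> P y.
  move=> cP HP; apply: (approx_closed cP) => e e0.
  by have [N HN] := Hy e e0; exists (sqrt_iter c N) => //; exact: HN.
have ny : `|y| <= 1.
  apply: (yapp [set a | `|a| <= 1]) => [|k /=].
    apply: closed_of_approx => a H /=; apply: le_of_le_eps.
    - exact: normr_real.
    - exact: real1.
    move=> e /H[s /= s1 sa].
    by rewrite -(subrK s a) addrC (le_trans (ler_normD _ _))// lerD.
  apply: le_trans (sqrt_iter_bound _ c1) _; rewrite (lecR _ 1).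
  by have [] := sqrt_majorant_bounds R k.
exists y; split => //.
- apply: (yapp [set a | cstar a = a]) => [|k]; last exact: sqrt_iter_sa.
  by apply: (@closed_eq_bounded _ _ _ _ 1) => // a b; rewrite -?cstarB ?cnorm_cstar mul1r.
- apply/eqP; rewrite -subr_eq0; apply/eqP/norm_small_eq0 => e e0.
  have [N HN] := Hy _ (divr_gt0 e0 (ltr0n _ 4)); set u := sqrt_iter c in HN.
  have yN := HN N (leqnn N); have yN1 := HN N.+1 (leqnSn N).
  (* the iteration, solved for c *)
  have cE : c = u N.+1 + u N.+1 - u N ** u N.
    by rewrite /u /= -scalerDl -[2^-1]mul1r -splitr scale1r addrK.
  have -> : y + y - y ** y - c = (y - u N.+1) + (y - u N.+1) - (y ** y - u N ** u N).
    rewrite {1}cE -[in RHS]addrACA -opprD !opprB addrACA [RHS]addrACA.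
    by rewrite (addrC (- (y ** y))).
  have -> : e = (e / 4 + e / 4) + (e / 4 + e / 4) by field.
  rewrite sqr_subE.
  rewrite (le_trans (ler_normB _ _))// lerD ?(le_trans (ler_normD _ _)) ?lerD//.
    by rewrite (le_trans (cnormM _ _))// -[leRHS]mulr1 ler_pM.
  rewrite (le_trans (cnormM _ _))// -[leRHS]mul1r ler_pM//.
  rewrite (le_trans (sqrt_iter_bound _ c1))// (lecR _ 1).
  by have [] := sqrt_majorant_bounds R N.
- by move=> C hC Cc; apply: yapp => [|k]; [case: hC|exact: sqrt_iter_mem].
Qed.

End SquareRoot.

(** * Positive elements of a C*-algebra with unit e *)
Section Unital.
Context {R : realType} {A : cstarAlgType R}.
Implicit Types (a b c d p q s x y z : A) (C : set A).
Variable e : A.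
Hypotheses (mule : forall a, e ** a = a) (mulre : forall a, a ** e = a).

Lemma cstar_unit : cstar e = e.
Proof.
by rewrite -[LHS]mulre -[in RHS](cstarK e) -[in RHS](mulre (cstar e)) cstarM cstarK.
Qed.

Lemma norm_unit_le1 : `|e| <= 1.
Proof.
have [->|e0] := eqVneq e 0; first by rewrite normr0.
have n0 : 0 < `|e| by rewrite normr_gt0.
by rewrite -(ler_pM2r n0) mul1r -expr2 -cnorm_star cstar_unit mule.
Qed.

(** Positivity without spectra: the condition says that the spectrum of the
    self-adjoint p lies in the interval from 0 to 2 l.  In this form it is
    evidently stable under sums. *)
Definition upos p := cstar p = p /\ exists2 l : R[i], 0 < l & `|l *: e - p| <= l.

Lemma uposZ p (k : R[i]) : 0 < k -> upos p -> upos (k *: p).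
Proof.
move=> k0 [sp [l l0 lp]]; split; first by rewrite cstarZnr ?sp// gtr0_real.
exists (k * l); first exact: mulr_gt0.
by rewrite -scalerA -scalerBr normrZ gtr0_norm// ler_pM2l.
Qed.

Lemma uposD p q : upos p -> upos q -> upos (p + q).
Proof.
move=> [sp [l l0 lp]] [sq [m m0 mq]]; split; first by rewrite cstarD sp sq.
exists (l + m); first exact: addr_gt0.
by rewrite scalerDl opprD addrACA (le_trans (ler_normD _ _))// lerD.
Qed.

Lemma upos0 : upos 0.
Proof.
split; first exact: cstar0.
by exists 1 => //; rewrite subr0 scale1r norm_unit_le1.
Qed.

(** With p = m^2 (e - c), the root is m (e - y) for the y of one_sub_sqrt. *)
Lemma upos_sqrt p : upos p -> exists s,
  [/\ cstar s = s, s ** s = p, upos s &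
      forall C, closed_subalgebra C -> C e -> C p -> C s].
Proof.
(* l is replaced by a larger square, in order to have a root at hand *)
move=> [sp [l l0 lp]]; pose m := l + 1; have m0 : 0 < m by rewrite addr_gt0.
have mp : `|(m * m) *: e - p| <= m * m.
  rewrite -[m * m](subrK l) scalerDl -addrA (le_trans (ler_normD _ _))// lerD//.
  have lm : 0 < m * m - l.
    have -> : m * m - l = l * l + l + 1 by rewrite /m; ring.
    by rewrite !addr_gt0// mulr_gt0.
  by rewrite normrZ gtr0_norm// ler_piMr ?norm_unit_le1 ?ltW//.
have mm0 : 0 < m * m by rewrite mulr_gt0.
pose c := e - (m * m)^-1 *: p.
have [||y [sy yE y1 Cy]] := @one_sub_sqrt _ _ c.
- by rewrite cstarB cstar_unit cstarZnr ?sp// rpredV gtr0_real.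
- have -> : c = (m * m)^-1 *: ((m * m) *: e - p).
    by rewrite scalerBr scalerA mulVf ?scale1r// gt_eqF.
  by rewrite normrZ gtr0_norm ?invr_gt0// ler_pdivrMl// mulr1.
exists (m *: (e - y)); split.
- by rewrite cstarZnr ?gtr0_real// cstarB cstar_unit sy.
- rewrite cmulZl cmulZr scalerA cmulBl !cmulBr !mule mulre.
  have -> : e - y - (y - y ** y) = (m * m)^-1 *: p.
    by rewrite -addrA -opprD addrA yE /c opprB addrC subrK.
  by rewrite scalerA divff ?scale1r// gt_eqF.
- split; first by rewrite cstarZnr ?gtr0_real// cstarB cstar_unit sy.
  exists m => //; rewrite -scalerBr opprB addrC subrK normrZ gtr0_norm//.
  by rewrite ler_piMr// ltW.
- move=> C hC Ce Cp; apply: csubalgZ => //; apply: csubalgB => //; apply: Cy => //.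
  by apply: csubalgB => //; apply: csubalgZ.
Qed.

Lemma upos_sqrt_comm p : upos p -> exists s,
  [/\ cstar s = s, s ** s = p, upos s &
      forall z, z ** p = p ** z -> z ** s = s ** z].
Proof.
move=> /upos_sqrt[s [ss sE ps Cs]]; exists s; split => // z zp.
apply: (Cs [set b | z ** b = b ** z]) => //; first exact: commutant_closed_subalgebra.
by rewrite /= mule mulre.
Qed.

Lemma unit_sub_sqr y : (e - y) ** (e - y) = e - (y + y - y ** y).
Proof.
rewrite cmulBl !cmulBr !mule mulre !opprB -!addrA; congr (_ + _).
by rewrite opprD addrCA.
Qed.

(** The root w of e - b^2 commutes with b, so that |w|^2 <= |w^2 + b^2| = |e|. *)
Lemma norm_unit_sub_sqr b : cstar b = b -> `|b| <= 1 -> `|e - b ** b| <= 1.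
Proof.
move=> sb b1.
have [||y [sy yE _ Cy]] := @one_sub_sqrt _ _ (b ** b).
- by rewrite cstarM sb.
- by rewrite (le_trans (cnormM _ _))// mulr_ile1.
have yb : b ** y = y ** b.
  by apply: (Cy _ (commutant_closed_subalgebra b)); rewrite /= cmulA.
pose w := e - y; have ww : w ** w = e - b ** b.
  by rewrite unit_sub_sqr yE.
have sw : cstar w = w by rewrite cstarB sy cstar_unit.
have wb : w ** b = b ** w by rewrite cmulBl cmulBr mule mulre yb.
rewrite -ww (cnorm_sa_sqr sw).
by rewrite (le_trans (norm_sqr_le_sqrD sw sb wb))// ww subrK norm_unit_le1.
Qed.

Lemma norm_sub_sqr s (m : R[i]) : cstar s = s -> 0 < m -> `|s| <= m ->
  `|(m * m) *: e - s ** s| <= m * m.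
Proof.
move=> ss m0 sm; pose b := m^-1 *: s; have sb : cstar b = b.
  by rewrite cstarZnr ?ss// rpredV gtr0_real.
have b1 : `|b| <= 1.
  by rewrite normrZ gtr0_norm ?invr_gt0// ler_pdivrMl// mulr1.
have -> : s ** s = (m * m) *: (b ** b).
  rewrite cmulZl cmulZr !scalerA [X in X *: _](_ : _ = 1) ?scale1r//.
  by field; rewrite gt_eqF.
have mm0 : 0 < m * m by exact: mulr_gt0.
rewrite -scalerBr normrZ (gtr0_norm mm0) -[leRHS]mulr1 ler_pM2l//.
exact: norm_unit_sub_sqr.
Qed.

Lemma sqr_upos s : cstar s = s -> upos (s ** s).
Proof.
move=> ss; split; first by rewrite cstarM ss.
have m0 : 0 < `|s| + 1 by rewrite ltr_wpDl.
exists ((`|s| + 1) * (`|s| + 1)); first exact: mulr_gt0.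
by apply: norm_sub_sqr => //; rewrite lerDl.
Qed.

Lemma upos_norm_sub p (m : R[i]) : upos p -> 0 < m -> `|p| <= m ->
  `|m *: e - p| <= m.
Proof.
move=> /upos_sqrt[s [ss <- _ _]] m0; rewrite cnorm_sa_sqr// => sm.
have mE : m = sqrtC m * sqrtC m by rewrite -expr2 sqrtCK.
rewrite {1 2}mE; apply: norm_sub_sqr; rewrite ?sqrtC_gt0//.
by rewrite -(ler_pXn2r (ltn0Sn 1)) ?nnegrE ?sqrtC_ge0 ?sqrtCK// ltW.
Qed.

(** By upos_norm_sub the witness l can be chosen uniformly on bounded sets. *)
Lemma upos_closed : closed upos.
Proof.
have sab a b : `|cstar a - cstar b| <= 1 * `|a - b| by rewrite -cstarB cnorm_cstar mul1r.
have idb a b : `|a - b| <= 1 * `|a - b| by rewrite mul1r.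
apply: closed_of_approx => p H; split.
  apply: (approx_closed (closed_eq_bounded ltr01 sab idb)) => k /H[q [sq _]].
  by exists q.
have m0 : 0 < `|p| + 1 by rewrite ltr_wpDl.
exists (`|p| + 1) => //.
apply: le_of_le_eps => [| |k k0]; rewrite ?normr_real ?gtr0_real//.
have k10 : 0 < k + 1 by rewrite addr_gt0.
have [q pq qp] := H (k / (k + 1)) (divr_gt0 k0 k10).
have q1 : `|q| <= `|p| + 1.
  have := ler_normD (q - p) p; rewrite subrK => /le_trans; apply.
  by rewrite addrC lerD// distrC (le_trans qp)// ler_pdivrMr// mul1r lerDl.
rewrite -(subrKA q) (le_trans (ler_normD _ _))// lerD//.
  exact: upos_norm_sub.
rewrite distrC (le_trans qp)// ler_pdivrMr// ler_peMr ?lerDr ?ltW//.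
Qed.

(** Roots s of p and t of - p commute, hence |s|^2 <= |s^2 + t^2| = 0. *)
Lemma upos_anti p : upos p -> upos (- p) -> p = 0.
Proof.
move=> /upos_sqrt_comm[s [ss sE _ Cs]] /upos_sqrt_comm[t [st tE _ Ct]].
have ts : t ** s = s ** t.
  apply: Cs; rewrite -[p]opprK -tE cmulNr cmulNl cmulA //.
have := norm_sqr_le_sqrD ss st (esym ts).
by rewrite -(cnorm_sa_sqr ss) sE tE subrr normr0 normr_le0 => /eqP.
Qed.

Lemma upos_add_eq0 p q : upos p -> upos q -> p + q = 0 -> p = 0.
Proof.
move=> pp pq pq0; apply: upos_anti => //.
by have /eqP := pq0; rewrite addr_eq0 => /eqP ->; rewrite opprK.
Qed.

(** With h and i k twice the real and imaginary parts of d, this is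
    (h^2 + k^2) / 2. *)
Lemma upos_starD d : upos (cstar d ** d + d ** cstar d).
Proof.
pose h := d + cstar d; pose k := 'i%C *: (cstar d - d).
have sh : cstar h = h by rewrite cstarD cstarK addrC.
have sk : cstar k = k.
  by rewrite cstarZ conj_imaginary cstarB cstarK scaleNr -scalerN opprB.
have -> : cstar d ** d + d ** cstar d = 2^-1 *: (h ** h + k ** k).
  have hh : h ** h = (d ** d + cstar d ** cstar d) + (cstar d ** d + d ** cstar d).
    by rewrite cmulDl !cmulDr (addrC (cstar d ** d)) addrACA (addrC (d ** cstar d)).
  have kk : k ** k = - ((d ** d + cstar d ** cstar d) - (cstar d ** d + d ** cstar d)).
    rewrite cmulZl cmulZr scalerA -expr2 sqr_i scaleN1r cmulBl !cmulBr; congr (- _).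
    by rewrite opprB addrACA -opprD (addrC (cstar d ** cstar d)).
  rewrite hh kk opprB (addrC _ (- _)) addrACA subrr add0r.
  by rewrite scalerDr -scalerDl -[2^-1]mul1r -splitr scale1r.
by apply: uposZ; rewrite ?invr_gt0//; apply: uposD; exact: sqr_upos.
Qed.

(** Kaplansky's argument.  Let x = c* c and w = |x|, the positive root of x^2;
    then u = w - x is twice the negative part of x, and one must show u = 0.
    Here d = c u has d* d = u x u = - u w u = - v^2 with v = sqrt w u.  The
    usual conclusion compares the spectra of d* d and q = d d*.  Instead, for
    f = v d* one has f* f = - q^2 and f f* = - v^4, whereas f* f + f f* is
    positive; so q = 0. *)
Lemma star_mul_upos c : upos (cstar c ** c).
Proof.
set x := cstar c ** c; have sx : cstar x = x by exact: cstar_sa_mul.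
have [w [sw wE pw Cw]] := upos_sqrt_comm (sqr_upos sx).
have xw : x ** w = w ** x by apply: Cw; rewrite cmulA.
have [r [sr rE _ Cr]] := upos_sqrt_comm pw.
pose u := w - x; have su : cstar u = u by rewrite cstarB sw sx.
have ru : u ** r = r ** u.
  by apply: Cr; rewrite cmulBl cmulBr xw.
pose v := r ** u; have sv : cstar v = v by rewrite cstarM sr su.
have xu : x ** u = - (w ** u).
  by rewrite !cmulBr wE opprB xw.
pose d := c ** u.
have dd : cstar d ** d = - (v ** v).
  rewrite cstarM su -cmulA (cmulA (cstar c)) -/x xu cmulNr -rE; congr (- _).
  by rewrite /v !cmulA ru.
pose f := v ** cstar d.
have f1 : cstar f ** f = - ((d ** cstar d) ** (d ** cstar d)).
  rewrite cstarM cstarK sv -cmulA (cmulA v) -[v ** v]opprK -dd cmulNl cmulNr.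
  by rewrite !cmulA.
have f2 : f ** cstar f = - ((v ** v) ** (v ** v)).
  rewrite /f cstarM cstarK sv -cmulA (cmulA (cstar d)) dd cmulNl cmulNr.
  by rewrite !cmulA.
have sdd : cstar (d ** cstar d) = d ** cstar d by rewrite cstarM cstarK.
have svv : cstar (v ** v) = v ** v by rewrite cstarM sv.
have := upos_starD f; rewrite f1 f2 -opprD => fneg.
have fpos := uposD (sqr_upos sdd) (sqr_upos svv).
have f0 := upos_anti fpos fneg.
have /(sa_sqr_eq0 sdd)/mul_cstar_eq0 d0 := upos_add_eq0 (sqr_upos sdd) (sqr_upos svv) f0.
have xu0 : x ** u = 0 by rewrite /x -cmulA -/d d0 cmul0r.
have u0 : u = 0.
  apply: (sa_sqr_eq0 su); rewrite {1}/u cmulBl xu0 subr0.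
  by rewrite -[LHS]opprK -xu xu0 oppr0.
have -> : x = w by apply/eqP; rewrite eq_sym -subr_eq0 -/u u0.
by [].
Qed.

Fixpoint upow y (k : nat) : A := if k is k'.+1 then y ** upow y k' else e.

Lemma upow_comm y z k : z ** y = y ** z -> z ** upow y k = upow y k ** z.
Proof.
move=> zy; elim: k => [|k IH] /=; first by rewrite mule mulre.
by rewrite cmulA zy -cmulA IH cmulA.
Qed.

Lemma upow_sa y k : cstar y = y -> cstar (upow y k) = upow y k.
Proof.
move=> sy; elim: k => [|k IH] /=; first exact: cstar_unit.
by rewrite cstarM IH sy upow_comm.
Qed.

Lemma upow_sqr w k : upow (w ** w) k = upow w k ** upow w k.
Proof.
elim: k => [|k IH] /=; first by rewrite mule.
by rewrite IH !cmulA -(cmulA w (upow w k)) -upow_comm// !cmulA.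
Qed.

Lemma upow_norm_le1 y k : `|y| <= 1 -> `|upow y k| <= 1.
Proof.
move=> y1; elim: k => [|k IH] /=; first exact: norm_unit_le1.
by rewrite (le_trans (cnormM _ _))// mulr_ile1.
Qed.

(** If t is the root of e - x^2 then |x|^2 <= |x^2 + t^2| = |e|. *)
Lemma norm_le1_of_upos x : cstar x = x -> upos (e - x ** x) -> `|x| <= 1.
Proof.
move=> sx /upos_sqrt_comm[t [st tE _ Ct]].
have xt : x ** t = t ** x.
  by apply: Ct; rewrite cmulBr cmulBl mule mulre cmulA.
have := norm_sqr_le_sqrD sx st xt; rewrite tE addrC subrK => h.
rewrite -(ler_pXn2r (ltn0Sn 1)) ?nnegrE// expr1n (le_trans h)//.
exact: norm_unit_le1.
Qed.

(** Let p = a a* and y = e - p.  The elements e - y^k - k p y^k increase with k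
    from 0, the increments being (k + 1) p^2 y^k.  Hence k p y^k <= e, which
    bounds the norm of p y^k by 1 / k; and |a* z|^2 = |p y^k| for z the root of
    y^k. *)
Lemma star_upow_small a (k : nat) : `|a| <= 1 -> (0 < k)%N ->
  `|cstar a ** upow (e - a ** cstar a) k| ^+ 2 <= k%:R^-1.
Proof.
move=> a1 k0; set p := a ** cstar a; set y := e - p.
have pp : upos p by rewrite /p -{1}(cstarK a); exact: star_mul_upos.
have sp : cstar p = p by case: pp.
have p1 : `|p| <= 1 by rewrite (le_trans (cnormM _ _))// cnorm_cstar mulr_ile1.
have sy : cstar y = y by rewrite cstarB cstar_unit sp.
have py : upos y.
  split=> //; exists 1 => //; by rewrite scale1r /y opprB addrC subrK.
have y1 : `|y| <= 1 by have := upos_norm_sub pp ltr01 p1; rewrite scale1r.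
have pyC : p ** y = y ** p by rewrite cmulBl cmulBr mule mulre.
have [w [sw wE _ Cw]] := upos_sqrt_comm py.
have w1 : `|w| <= 1.
  by rewrite -(ler_pXn2r (ltn0Sn 1)) ?nnegrE// expr1n -cnorm_sa_sqr// wE.
have [s [ss sE _ Cs]] := upos_sqrt_comm pp.
have sw' : s ** w = w ** s by rewrite Cs // Cw.
have wp : p ** w = w ** p by exact: Cw.
have yE l : upow y l = upow w l ** upow w l by rewrite -wE upow_sqr.
have sz l : cstar (upow w l) = upow w l by exact: upow_sa.
have pz l : p ** upow w l = upow w l ** p by exact: upow_comm.
have G l : upos (e - upow y l - l%:R *: (p ** upow y l)).
  elim: l => [|l IH]; first by rewrite /= subrr scale0r subrr; exact: upos0.
  have -> : e - upow y l.+1 - l.+1%:R *: (p ** upow y l.+1) =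
     (e - upow y l - l%:R *: (p ** upow y l)) + l.+1%:R *: (p ** (p ** upow y l)).
    have yY : y ** upow y l = upow y l - p ** upow y l by rewrite {1}/y cmulBl mule.
    rewrite /= yY cmulBr scalerBr !opprB (addrC (l.+1%:R *: (p ** (p ** _)))) addrA.
    congr (_ + _); rewrite -natr1 scalerDl scale1r opprD (addrC (p ** upow y l)) (addrA e).
    by rewrite -[LHS]addrA; congr (_ + _); rewrite addrC subrK.
  apply: uposD => //; apply: uposZ => //.
  have -> : p ** (p ** upow y l) = (p ** upow w l) ** (p ** upow w l).
    by rewrite yE -cmulA; congr (p ** _); rewrite cmulA {1}pz -cmulA.
  by apply: sqr_upos; rewrite cstarM sz sp pz.
set z := upow w k; set Y := upow y k.
have sxz : cstar (s ** z) = s ** z by rewrite cstarM sz ss upow_comm.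
have xzE : (s ** z) ** (s ** z) = p ** Y.
  rewrite /Y yE -sE -!cmulA; congr (s ** _).
  by rewrite !cmulA /z -(upow_comm k sw').
have kx : `|s ** z| ^+ 2 <= k%:R^-1.
  have kk : 0 <= sqrtC k%:R :> R[i] by rewrite sqrtC_ge0.
  have : `|sqrtC k%:R *: (s ** z)| <= 1.
    apply: norm_le1_of_upos; first by rewrite cstarZnr ?sxz// ger0_real.
    rewrite cmulZl cmulZr scalerA -expr2 sqrtCK xzE.
    rewrite -[e](subrK Y) addrAC; apply: uposD; first exact: G.
    by rewrite /Y yE; apply: sqr_upos.
  rewrite -(ler_pXn2r (ltn0Sn 1)) ?nnegrE// expr1n normrZ exprMn ger0_norm//.
  by rewrite sqrtCK -ler_pdivlMl ?ltr0n// mulr1.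
have -> : cstar a ** Y = (cstar a ** z) ** z by rewrite /Y yE cmulA.
apply: le_trans kx; rewrite -(cnorm_sa_sqr sxz) xzE.
have -> : p ** Y = cstar (cstar a ** z) ** (cstar a ** z).
  by rewrite /Y yE cstarM cstarK sz -/z cmulA pz -!cmulA.
rewrite cnorm_star lerXn2r ?nnegrE// (le_trans (cnormM _ _))//.
by rewrite ler_piMr// upow_norm_le1.
Qed.

End Unital.

(** * The unitization *)
Section Unitization.
Context {R : realType}.

Definition unitization (A : cstarAlgType R) : Type := (R[i]^o * A)%type.

HB.instance Definition _ (A : cstarAlgType R) :=
  GRing.Lmodule.copy (unitization A) (R[i]^o * A)%type.

Context {A : cstarAlgType R}.
Local Notation U := (unitization A).
Implicit Types (x y z : U) (a b : A).

(** The pair x = (l, a) stands for l + a and acts on A by left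
    multiplication. *)
Definition uact x b : A := x.1 *: b + x.2 ** b.
Definition umul x y : U := (x.1 * y.1, x.1 *: y.2 + y.1 *: x.2 + x.2 ** y.2).
Definition ustar x : U := (x.1^*%R, cstar x.2).

Lemma uactD x y b : uact (x + y) b = uact x b + uact y b.
Proof. by rewrite /uact /= scalerDl cmulDl addrACA. Qed.

Lemma uactZ (k : R[i]) x b : uact (k *: x) b = k *: uact x b.
Proof. by rewrite /uact /= scalerDr scalerA cmulZl. Qed.

Lemma uactM x y b : uact (umul x y) b = uact x (uact y b).
Proof.
rewrite /uact /umul /= !cmulDl !cmulDr !cmulZl !cmulZr scalerDr scalerA cmulA.
by rewrite -!addrA.
Qed.

Lemma cstar_uact x b : cstar (uact x b) ** uact x b = cstar b ** uact (umul (ustar x) x) b.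
Proof.
rewrite uactM /uact /ustar /= cstarD cstarZ cstarM.
by rewrite [RHS]cmulDr cmulZr cmulDl cmulZl cmulA.
Qed.

Definition unorm_set x : set R := [set complex.Re `|uact x b| | b in [set b | `|b| <= 1]].

(** If A has a unit already then the operator norm alone is only a seminorm on
    the unitization; the scalar part repairs this. *)
Definition unorm x : R[i] :=
  ((Num.max (complex.Re `|x.1|) (sup (unorm_set x)))%:C)%C.

Lemma Re_normK (z : A) : ((complex.Re `|z|)%:C)%C = `|z|.
Proof. by rewrite RRe_real ?normr_real. Qed.

Lemma ReC_normK (z : R[i]) : ((complex.Re `|z|)%:C)%C = `|z|.
Proof. by rewrite RRe_real ?normr_real. Qed.

Lemma unorm_set_has_sup x : has_sup (unorm_set x).
Proof.
split; first by exists (complex.Re `|uact x 0|); exists 0; rewrite //= normr0.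
exists (complex.Re (`|x.1| + `|x.2|)) => _ [b /= b1 <-].
rewrite -lecR Re_normK RRe_real ?rpredD ?normr_real//.
rewrite (le_trans (ler_normD _ _))// lerD//.
  by rewrite normrZ ler_piMr.
by rewrite (le_trans (cnormM _ _))// ler_piMr.
Qed.

(** Every property of the norm is derived from this characterization. *)
Lemma unormP x (M : R[i]) : 0 <= M ->
  unorm x <= M <-> (`|x.1| <= M /\ forall b, `|uact x b| <= M * `|b|).
Proof.
move=> M0; have /complex_realP[m mE] := ger0_real M0.
rewrite /unorm {}mE in M0 *; rewrite lecR ge_max -(lecR (complex.Re `|x.1|)) ReC_normK.
split.
  move=> /andP[x1 xs]; split=> // b.
  have [->|b0] := eqVneq b 0.
    by rewrite /uact scaler0 cmul0r addr0 !normr0 mulr0.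
  have nb0 : 0 < `|b| by rewrite normr_gt0.
  have : complex.Re `|uact x (`|b|^-1 *: b)| <= m.
    apply: le_trans xs; apply: ub_le_sup; first by case: (unorm_set_has_sup x).
    by exists (`|b|^-1 *: b); rewrite //= normrZ normfV normr_id mulVf ?gt_eqF.
  have -> : uact x (`|b|^-1 *: b) = `|b|^-1 *: uact x b.
    by rewrite /uact cmulZr scalerDr !scalerA mulrC.
  by rewrite -lecR Re_normK normrZ normfV normr_id ler_pdivrMl// mulrC.
move=> [x1 xb]; rewrite x1 /=; apply: ge_sup => [|_ [b /= b1 <-]].
  by case: (unorm_set_has_sup x).
by rewrite -lecR Re_normK (le_trans (xb b))// ler_piMr.
Qed.

Lemma unorm_ge0 x : 0 <= unorm x.
Proof. by rewrite ler0c le_max -ler0c ReC_normK normr_ge0. Qed.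

Lemma unorm_scalar x : `|x.1| <= unorm x.
Proof. by have /unormP[] := lexx (unorm x); first exact: unorm_ge0. Qed.

Lemma unorm_uact x b : `|uact x b| <= unorm x * `|b|.
Proof. by have /unormP[|_ ->] := lexx (unorm x); first exact: unorm_ge0. Qed.

Lemma unorm_triangle x y : unorm (x + y) <= unorm x + unorm y.
Proof.
apply/unormP; first by rewrite addr_ge0 ?unorm_ge0.
split=> [|b]; first by rewrite (le_trans (ler_normD _ _))// lerD ?unorm_scalar.
by rewrite uactD mulrDl (le_trans (ler_normD _ _))// lerD ?unorm_uact.
Qed.

Lemma unormZ_le (k : R[i]) x : unorm (k *: x) <= `|k| * unorm x.
Proof.
apply/unormP; first by rewrite mulr_ge0 ?unorm_ge0.
split=> [|b]; first by rewrite normrM ler_wpM2l ?unorm_scalar.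
by rewrite uactZ normrZ -mulrA ler_wpM2l ?unorm_uact.
Qed.

Lemma unormZ (k : R[i]) x : unorm (k *: x) = `|k| * unorm x.
Proof.
apply/eqP; rewrite eq_le unormZ_le /=.
have [->|k0] := eqVneq k 0; first by rewrite normr0 mul0r unorm_ge0.
have nk0 : 0 < `|k| by rewrite normr_gt0.
rewrite -ler_pdivlMl// -normfV.
by apply: le_trans (unormZ_le _ _); rewrite scalerA mulVf// scale1r.
Qed.

(** Together with unorm_le_sum: the norm is equivalent to |l| + |a|, whence
    completeness. *)
Lemma norm_snd_le x : `|x.2| <= 2 * unorm x.
Proof.
have [->|x0] := eqVneq x.2 0; first by rewrite normr0 mulr_ge0 ?unorm_ge0.
have nx0 : 0 < `|x.2| by rewrite normr_gt0.
have n2 : `|x.2| * `|x.2| = `|x.2 ** cstar x.2|.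
  by rewrite cnorm_star_r expr2.
rewrite -(ler_pM2r nx0) n2 -(cnorm_cstar x.2).
have -> : x.2 ** cstar x.2 = uact x (cstar x.2) - x.1 *: cstar x.2.
  by rewrite /uact addrC addKr.
rewrite (le_trans (ler_normB _ _))// mulr_natl mulr2n mulrDl lerD ?unorm_uact//.
by rewrite normrZ ler_wpM2r// unorm_scalar.
Qed.

Lemma unorm_eq0 x : unorm x = 0 -> x = 0.
Proof.
move=> x0; have := unorm_scalar x; have := norm_snd_le x.
rewrite x0 mulr0 !normr_le0; case: x {x0} => l a /= /eqP -> /eqP ->; exact: erefl.
Qed.

Lemma unorm_le_sum x : unorm x <= `|x.1| + `|x.2|.
Proof.
apply/unormP; rewrite ?addr_ge0//; split=> [|b]; first by rewrite lerDl.
rewrite (le_trans (ler_normD _ _))// mulrDl lerD ?normrZ//; exact: cnormM.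
Qed.

HB.instance Definition _ :=
  Lmodule_isNormed.Build R[i] U unorm_triangle unormZ unorm_eq0.

Lemma norm_real_complex (r : R) : `|(r%:C)%C| = ((`|r|)%:C)%C :> R[i].
Proof. by rewrite normc_def /= expr0n addr0 sqrtr_sqr. Qed.

Lemma norm_complex_le (z : R[i]) :
  `|z| <= (`|complex.Re z|%:C)%C + (`|complex.Im z|%:C)%C.
Proof.
rewrite {1}[z]complexE (le_trans (ler_normD _ _))// normrM -!norm_real_complex.
rewrite [X in _ + X * _](_ : _ = 1) ?mul1r//.
by rewrite normc_def /= expr0n add0r expr1n sqrtr1.
Qed.

Lemma unitization_complete (F : set_system U) :
  ProperFilter F -> cauchy F -> cvg F.
Proof.
move=> FF /cauchyP FC.
have part (f : U -> R) : (forall z w, (`|f z - f w|%:C)%C <= `|z - w|) ->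
    exists l : R, f @ F --> l.
  move=> fl; apply/cvg_ex/cauchy_cvgP/cauchy_exP => e e0.
  have [|z Fz] := FC (e%:C)%C; first by rewrite ltcR.
  exists (f z); change (F (f @^-1` ball (f z) e)).
  apply: filterS Fz => w; rewrite /preimage -!ball_normE /= => zw.
  rewrite -ltcR; exact: le_lt_trans (fl _ _) zw.
have [|l Fl] := part (fun z => complex.Re z.1).
  move=> z w; rewrite -raddfB; apply: le_trans (unorm_scalar _).
  exact: normc_ge_Re.
have [|m Fm] := part (fun z => complex.Im z.1).
  move=> z w; rewrite -raddfB; apply: le_trans (unorm_scalar _).
  rewrite normc_def lecR -sqrtr_sqr ler_wsqrtr// lerDr sqr_ge0//.
have /cvg_ex[a Fa] : cvg ((fun z : U => z.2) @ F).
  apply/cauchy_cvgP/cauchy_exP => e e0.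
  have [|z Fz] := FC (e / 2); first by rewrite divr_gt0.
  exists z.2; change (F ((fun x : U => x.2) @^-1` ball z.2 e)).
  apply: filterS Fz => w; rewrite /preimage -!ball_normE /= => zw.
  by rewrite (le_lt_trans (norm_snd_le (z - w)))// mulrC -ltr_pdivlMr.
apply/cvg_ex; exists ((l +i* m)%C, a); apply/cvgrPdist_le => e0 /pos_complexP[e e_gt0 ->].
have e40 : 0 < e / 4 by rewrite divr_gt0.
have ec0 : 0 < ((e / 4)%:C)%C :> R[i] by rewrite ltcR.
move/cvgrPdist_le : Fl => /(_ _ e40) Fl; move/cvgrPdist_le : Fm => /(_ _ e40) Fm.
move/cvgrPdist_le : Fa => /(_ _ ec0) Fa.
near=> z.
have zl : `|l - complex.Re z.1| <= e / 4 by near: z.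
have zm : `|m - complex.Im z.1| <= e / 4 by near: z.
have za : `|a - z.2| <= ((e / 4)%:C)%C by near: z.
rewrite (le_trans (unorm_le_sum _))//.
rewrite (le_trans (lerD (norm_complex_le _) za))// -!rmorphD lecR /=.
case: (z.1) zl zm => p q /= zl zm; lra.
Unshelve. all: by end_near. Qed.

HB.instance Definition _ := Uniform_isComplete.Build U unitization_complete.
End Unitization.

Section UnitizationCStar.
Context {R : realType} {A : cstarAlgType R}.
Local Notation U := (unitization A).
Implicit Types (x y z : U) (a b : A).

Lemma uext x y : x.1 = y.1 -> x.2 = y.2 -> x = y.
Proof. by case: x y => [? ?] [? ?] /= -> ->. Qed.

(** Elements with the same scalar part and the same action are equal, which
    turns associativity into a property of composition. *)
Lemma uact_ext x y : x.1 = y.1 -> uact x =1 uact y -> x = y.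
Proof.
move=> xy1 xy; apply/eqP; rewrite -subr_eq0 -normr_le0.
apply/unormP => //; split=> [|b]; first by rewrite /= xy1 subrr normr0.
by rewrite -scaleN1r uactD uactZ xy scaleN1r subrr normr0 mul0r.
Qed.

Lemma umulA : associative (@umul R A).
Proof.
move=> x y z; apply: uact_ext => [|b]; first exact: mulrA.
by rewrite !uactM.
Qed.

Lemma umulDl : left_distributive (@umul R A) +%R.
Proof.
move=> x y z; apply: uext => /=; first exact: mulrDl.
by rewrite scalerDl scalerDr cmulDl [RHS]addrACA; congr (_ + _); exact: addrACA.
Qed.

Lemma umulDr : right_distributive (@umul R A) +%R.
Proof.
move=> x y z; apply: uext => /=; first exact: mulrDr.
by rewrite scalerDl scalerDr cmulDr [RHS]addrACA; congr (_ + _); exact: addrACA.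
Qed.

Lemma umulZl (c : R[i]) x y : umul (c *: x) y = c *: umul x y.
Proof.
apply: uext => /=; first by rewrite -mulrA.
by rewrite !scalerDr !scalerA cmulZl (mulrC c y.1).
Qed.

Lemma umulZr (c : R[i]) x y : umul x (c *: y) = c *: umul x y.
Proof.
apply: uext => /=; first by rewrite mulrCA.
by rewrite !scalerDr !scalerA cmulZr (mulrC c x.1).
Qed.

Lemma ustarK : involutive (@ustar R A).
Proof. by move=> x; apply: uext => /=; [exact: conjCK|exact: cstarK]. Qed.

Lemma ustarD : {morph (@ustar R A) : x y / x + y}.
Proof. by move=> x y; apply: uext => /=; [exact: rmorphD|exact: cstarD]. Qed.

Lemma ustarZ (c : R[i]) x : ustar (c *: x) = c^*%R *: ustar x.
Proof. by apply: uext => /=; [exact: rmorphM|exact: cstarZ]. Qed.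

Lemma ustarM x y : ustar (umul x y) = umul (ustar y) (ustar x).
Proof.
apply: uext => /=; first by rewrite rmorphM mulrC.
by rewrite !cstarD !cstarZ cstarM (addrC (_ *: cstar y.2)).
Qed.

Lemma unormM x y : `|umul x y| <= `|x| * `|y|.
Proof.
apply/unormP; first exact: mulr_ge0.
split=> [|b]; first by rewrite /= normrM ler_pM// unorm_scalar.
rewrite uactM (le_trans (unorm_uact _ _))// -mulrA ler_wpM2l ?unorm_ge0//.
exact: unorm_uact.
Qed.

Lemma unorm_star_ge x : `|x| ^+ 2 <= `|umul (ustar x) x|.
Proof.
set N := `|umul (ustar x) x|; have N0 : 0 <= N by exact: normr_ge0.
have sN0 : 0 <= sqrtC N by rewrite sqrtC_ge0.
rewrite -[N]sqrtCK lerXn2r ?nnegrE//; apply/unormP => //; split=> [|b].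
  rewrite -(ler_pXn2r (ltn0Sn 1)) ?nnegrE// sqrtCK.
  have h (k : R[i]) : `|k^*%R * k| = `|k| ^+ 2 by rewrite normrM norm_conjC.
  by rewrite -h; exact: (unorm_scalar (umul (ustar x) x)).
rewrite -(ler_pXn2r (ltn0Sn 1)) ?nnegrE ?mulr_ge0// exprMn sqrtCK.
rewrite -cnorm_star cstar_uact (le_trans (cnormM _ _))// cnorm_cstar mulrC expr2 mulrA.
by rewrite ler_wpM2r// unorm_uact.
Qed.

Lemma unorm_star x : `|umul (ustar x) x| = `|x| ^+ 2.
Proof.
have le y : `|y| <= `|ustar y|.
  have [->|y0] := eqVneq y 0; first by rewrite normr0.
  have ny0 : 0 < `|y| by rewrite normr_gt0.
  by rewrite -(ler_pM2r ny0) -expr2 (le_trans (unorm_star_ge _))// unormM.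
apply/eqP; rewrite eq_le unorm_star_ge andbT (le_trans (unormM _ _))//.
by rewrite expr2 ler_wpM2r// -{2}(ustarK x) le.
Qed.

HB.instance Definition _ := isCStarAlgebra.Build R U
  umulA umulDl umulDr umulZl umulZr ustarK ustarD ustarZ ustarM unormM unorm_star.

End UnitizationCStar.

(** * Positivity, ideals and homomorphisms without a unit *)
Section Embedding.
Context {R : realType} {A : cstarAlgType R}.
Local Notation U := (unitization A).
Implicit Types (x y z : U) (a b p : A) (B I : set A).

Definition uone : U := (1, 0).
Definition emb a : U := (0, a).

Lemma uone_mull x : uone ** x = x.
Proof. by apply: uext => /=; rewrite ?mul1r// scale1r scaler0 addr0 cmul0l addr0. Qed.

Lemma uone_mulr x : x ** uone = x.
Proof. by apply: uext => /=; rewrite ?mulr1// scaler0 scale1r add0r cmul0r addr0. Qed.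

Lemma embD a b : emb (a + b) = emb a + emb b.
Proof. by apply: uext; rewrite /= ?addr0. Qed.

Lemma embN a : emb (- a) = - emb a.
Proof. by apply: uext; rewrite /= ?oppr0. Qed.

Lemma embZ (k : R[i]) a : emb (k *: a) = k *: emb a.
Proof. by apply: uext => //; exact/esym/mulr0. Qed.

Lemma embM a b : emb (a ** b) = emb a ** emb b.
Proof. by apply: uext; rewrite /= ?mulr0// !scale0r !add0r. Qed.

Lemma emb_star a : emb (cstar a) = cstar (emb a).
Proof. by apply: uext; rewrite /= ?rmorph0. Qed.

Lemma emb_norm a : `|emb a| = `|a|.
Proof.
apply/eqP; rewrite eq_le (le_trans (unorm_le_sum _)) ?normr0 ?add0r//=.
have [->|a0] := eqVneq a 0; first by rewrite normr0.
have na0 : 0 < `|cstar a| by rewrite cnorm_cstar normr_gt0.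
rewrite -(ler_pM2r na0) {1}cnorm_cstar -expr2 -cnorm_star_r.
by have := unorm_uact (emb a) (cstar a); rewrite /uact scale0r add0r.
Qed.

(** Positivity in A is positivity in the unitization of A. *)
Definition cpos p := upos uone (emb p).

Lemma cposZ p (k : R[i]) : 0 < k -> cpos p -> cpos (k *: p).
Proof. by rewrite /cpos embZ; exact: uposZ. Qed.

Lemma cposD p q : cpos p -> cpos q -> cpos (p + q).
Proof. by rewrite /cpos embD; exact: uposD. Qed.

Lemma cpos0 : cpos 0.
Proof. exact: (upos0 uone_mull uone_mulr). Qed.

Lemma cpos_sum (T : Type) (r : seq T) (P : pred T) (F : T -> A) :
  (forall i, P i -> cpos (F i)) -> cpos (\sum_(i <- r | P i) F i).
Proof. by move=> H; apply: big_ind => //; [exact: cpos0|exact: cposD]. Qed.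

Lemma star_mul_cpos a : cpos (cstar a ** a).
Proof. by rewrite /cpos embM emb_star; exact: (star_mul_upos uone_mull uone_mulr). Qed.

Lemma cpos_add_eq0 p q : cpos p -> cpos q -> p + q = 0 -> p = 0.
Proof.
move=> pp pq pq0; have : emb p = 0.
  by apply: (upos_add_eq0 uone_mull uone_mulr pp pq); rewrite -embD pq0.
by case.
Qed.

Lemma cpos_closed : closed cpos.
Proof.
apply: closed_of_approx => p H; apply: (approx_closed (upos_closed uone_mull uone_mulr)).
move=> e /H[q pq qp]; exists (emb q) => //.
by rewrite -embN -embD emb_norm.
Qed.

(** The root s taken in the unitization has scalar part 0, as p has; and it lies
    in the span of B and the unit, which is a closed subalgebra. *)
Lemma cpos_sqrt p B : closed_subalgebra B -> cpos p -> B p ->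
  exists s, [/\ cstar s = s, s ** s = p & B s].
Proof.
move=> [cB B0 Blin Bmul] /(upos_sqrt uone_mull uone_mulr)[s [ss sE _ Cs]] Bp.
have hB : closed_subalgebra B by [].
have s1 : s.1 = 0.
  have /(congr1 fst)/= /eqP := sE; rewrite mulf_eq0 orbb => /eqP //.
exists s.2; split.
- by have /(congr1 snd) := ss.
- by have /(congr1 snd)/= := sE; rewrite s1 !scale0r !add0r.
apply: (Cs [set x | B x.2]) => //; split=> //=.
- apply: closed_of_approx => x H /=; apply: (approx_closed cB) => e e0.
  have [y /= By yx] := H (e / 2) (divr_gt0 e0 (ltr0n _ 2)).
  exists y.2 => //; apply: le_trans (norm_snd_le (x - y)) _.
  by rewrite mulrC -ler_pdivlMr.
- by move=> c x y; exact: Blin.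
- move=> x y Bx By; apply: csubalgD => //; last exact: Bmul.
  by apply: csubalgD => //; apply: csubalgZ.
Qed.

(** For p = a a* the elements a* (1 - (1 - p)^k) tend to a* by star_upow_small,
    and the second factor is in I as a polynomial in p without constant term. *)
Lemma closed_ideal_star I a : closed_ideal I -> I a -> I (cstar a).
Proof.
move=> [cI I0 Ilin Il Ir] Ia.
have IZ (k : R[i]) b : I b -> I (k *: b) by move=> Ib; rewrite -[_ *: _]addr0; exact: Ilin.
have ID b c : I b -> I c -> I (b + c) by move=> Ib Ic; rewrite -[b]scale1r; exact: Ilin.
wlog a1 : a Ia / `|a| <= 1.
  move=> H; have [->|a0] := eqVneq a 0; first by rewrite cstar0.
  have na0 : 0 < `|a| by rewrite normr_gt0.
  have -> : a = `|a| *: (`|a|^-1 *: a) by rewrite scalerA divff ?scale1r// gt_eqF.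
  rewrite cstarZnr ?gtr0_real//; apply: (IZ); apply: H; first exact: IZ.
  by rewrite normrZ normfV normr_id mulVf// gt_eqF.
set p := emb a ** cstar (emb a).
have powE k : exists2 c, I c & upow uone (uone - p) k = uone - emb c.
  elim: k => [|k [c Ic IH]] /=; first by exists 0 => //; rewrite subr0.
  have pE : p = emb (a ** cstar a) by rewrite /p -emb_star -embM.
  exists (a ** cstar a + (c - a ** cstar a ** c)).
    have Iaa : I (a ** cstar a) by exact: Ir.
    by apply: (ID) => //; apply: ID => //; rewrite -scaleN1r; apply: IZ; apply: Ir.
  rewrite IH cmulBr uone_mulr cmulBl uone_mull pE -embM !embD !embN [in RHS]opprD.
  by rewrite addrA.
apply: (approx_closed cI) => e e0.
have [N HN] := invn_small (mulr_gt0 e0 e0).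
have ea1 : `|emb a| <= 1 by rewrite emb_norm.
have := star_upow_small uone_mull uone_mulr ea1 (ltn0Sn N); rewrite -/p.
have [c Ic ->] := powE N.+1; rewrite cmulBr uone_mulr -emb_star -embM -embN -embD emb_norm.
move=> h; exists (cstar a ** c); first exact: Il.
rewrite -(ler_pXn2r (ltn0Sn 1)) ?nnegrE//; last exact: ltW.
by rewrite (le_trans h)// (le_trans (HN N (leqnn N)))// expr2.
Qed.

(** The equation says (1 - y)^2 + b^2 = 1 in the unitization.  It is an algebraic
    certificate of |b| <= 1 in terms of elements of A. *)
Lemma norm_le1_of_sub_sqr b (y : A) : cstar b = b -> cstar y = y -> b ** y = y ** b ->
  y + y - y ** y = b ** b -> `|b| <= 1.
Proof.
move=> sb sy yb yE; have yE' := congr1 emb yE; rewrite !embD embN !embM in yE'.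
pose w : U := uone - emb y.
have sw : cstar w = w by rewrite cstarB -emb_star sy (cstar_unit uone_mulr).
have sb' : cstar (emb b) = emb b by rewrite -emb_star sb.
have wb : emb b ** w = w ** emb b.
  by rewrite cmulBl cmulBr uone_mull uone_mulr -!embM yb.
have := norm_sqr_le_sqrD sb' sw wb.
have -> : emb b ** emb b + w ** w = uone.
  by rewrite -yE' (unit_sub_sqr uone_mull uone_mulr) addrC subrK.
rewrite emb_norm => h; rewrite -(ler_pXn2r (ltn0Sn 1)) ?nnegrE// expr1n.
by rewrite (le_trans h)// (norm_unit_le1 uone_mull uone_mulr).
Qed.

(** For self-adjoint b in the unit ball, one_sub_sqrt gives y in I with
    2 y - y^2 = b^2, and f transports this certificate of norm_le1_of_sub_sqr. *)
Lemma star_hom_contractive I (f : A -> A) a : closed_ideal I ->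
  (forall (c : R[i]) a b, I a -> I b -> f (c *: a + b) = c *: f a + f b) ->
  (forall a b, I a -> I b -> f (a ** b) = f a ** f b) ->
  (forall a, I a -> f (cstar a) = cstar (f a)) ->
  I a -> `|f a| <= `|a|.
Proof.
move=> hI flin fmul fstar Ia; have [cI I0 Ilin Il Ir] := hI.
have sI : closed_subalgebra I by split=> // b c Ib Ic; exact: Ir.
have f0 : f 0 = 0.
  have := flin (-1) 0 0 I0 I0; rewrite scaler0 addr0 => ->.
  by rewrite scaleN1r addNr.
have fZ k b : I b -> f (k *: b) = k *: f b.
  by move=> Ib; rewrite -[k *: b]addr0 flin// f0 addr0.
have fD b c : I b -> I c -> f (b + c) = f b + f c.
  by move=> Ib Ic; rewrite -[b in LHS]scale1r flin// scale1r.
have sa1 b : I b -> cstar b = b -> `|b| <= 1 -> `|f b| <= 1.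
  move=> Ib sb b1; have [||y [sy yE _ Cy]] := @one_sub_sqrt _ _ (b ** b).
  - by rewrite cstarM sb.
  - by rewrite (le_trans (cnormM _ _))// mulr_ile1.
  have Iy : I y by apply: Cy => //; exact: Il.
  have by_ : b ** y = y ** b.
    by apply: (Cy _ (commutant_closed_subalgebra b)); rewrite /= cmulA.
  have Iyy : I (y ** y) by exact: Il.
  apply: (@norm_le1_of_sub_sqr _ (f y)).
  - by rewrite -fstar ?sb.
  - by rewrite -fstar ?sy.
  - by rewrite -!fmul ?by_.
  - rewrite -!fmul// -yE fD ?fD//; [|exact: csubalgD|exact: csubalgN].
    by rewrite -[in RHS]scaleN1r fZ// scaleN1r.
have sa b : I b -> cstar b = b -> `|f b| <= `|b|.
  move=> Ib sb; have [->|b0] := eqVneq b 0; first by rewrite f0.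
  have nb0 : 0 < `|b| by rewrite normr_gt0.
  have := sa1 (`|b|^-1 *: b); rewrite fZ// !normrZ normfV normr_id.
  rewrite mulVf ?gt_eqF// ler_pdivrMl// mulr1; apply=> //.
    exact: csubalgZ.
  by rewrite cstarZnr ?sb// rpredV gtr0_real.
rewrite -(ler_pXn2r (ltn0Sn 1)) ?nnegrE// -!cnorm_star -fstar// -fmul//.
  by apply: sa; [exact: Il|exact: cstar_sa_mul].
exact: closed_ideal_star.
Qed.

End Embedding.

(** * Components of an element in closed ideals *)

(** W is the graph of a partially defined contractive linear map.  When it is
    closed, so is the domain of the map, by completeness.  In this way both the
    projections onto the ideals A_t and the averaging map are extended from the
    dense sum of the A_t to A. *)
Section ContractiveRelation.
Context {R : realType} {A : cstarAlgType R}.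
Variable W : A -> A -> Prop.
Hypothesis W_linear : forall (k : R[i]) a b a' b', W a b -> W a' b' ->
  W (k *: a + a') (k *: b + b').
Hypothesis W_contr : forall a b, W a b -> `|b| <= `|a|.
Hypothesis W_closed : forall a b,
  (forall e : R[i], 0 < e -> exists a' b', [/\ W a' b', `|a - a'| <= e & `|b - b'| <= e]) ->
  W a b.

Lemma contractive_dom_closed : closed [set a | exists b, W a b].
Proof.
apply: closed_of_approx => a H /=.
have /choice[p Hp] (k : nat) : exists p : A * A,
    W p.1 p.2 /\ `|a - p.1| <= k.+1%:R^-1.
  have [|c /= [d Wcd] ac] := H (k.+1%:R^-1); first by rewrite invr_gt0.
  by exists (c, d).
have [|l Hl] := @cauchy_seq_cvg _ _ (fun k => (p k).2).
  move=> e e0; have [N HN] := invn_small (divr_gt0 e0 (ltr0n _ 2)).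
  exists N => m k Nm Nk.
  have : W (-1 *: (p k).1 + (p m).1) (-1 *: (p k).2 + (p m).2).
    by apply: W_linear; [case: (Hp k)|case: (Hp m)].
  move=> /W_contr; rewrite !scaleN1r !(addrC (- _)) => /le_trans; apply.
  rewrite -(subrKA a) [e]splitr (le_trans (ler_normD _ _))// lerD//.
    by rewrite distrC; have [_ /le_trans] := Hp m; apply; exact: HN.
  by have [_ /le_trans] := Hp k; apply; exact: HN.
exists l; apply: W_closed => e e0.
have [N HN] := invn_small e0; have [M HM] := Hl e e0.
exists (p (maxn N M)).1, (p (maxn N M)).2; have [Wp ap] := Hp (maxn N M).
split => //; last by apply: HM; exact: leq_maxr.
by apply: le_trans ap _; apply: HN; exact: leq_maxl.
Qed.

End ContractiveRelation.

Section IdealComponent.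
Context {R : realType} {A : cstarAlgType R}.
Implicit Types (a b c : A) (I : set A).

Lemma ideal0 I : closed_ideal I -> I 0. Proof. by case. Qed.

Lemma idealZ I (k : R[i]) a : closed_ideal I -> I a -> I (k *: a).
Proof. by case=> _ I0 lin _ _ Ia; rewrite -[_ *: _]addr0; exact: lin. Qed.

Lemma idealD I a b : closed_ideal I -> I a -> I b -> I (a + b).
Proof. by case=> _ _ lin _ _ Ia Ib; rewrite -[a]scale1r; exact: lin. Qed.

Lemma idealN I a : closed_ideal I -> I a -> I (- a).
Proof. by move=> hI Ia; rewrite -scaleN1r; exact: idealZ. Qed.

Lemma idealB I a b : closed_ideal I -> I a -> I b -> I (a - b).
Proof. by move=> hI Ia Ib; apply: idealD => //; exact: idealN. Qed.

Lemma ideal_mull I a b : closed_ideal I -> I b -> I (a ** b).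
Proof. by case=> _ _ _ h _; exact: h. Qed.

Lemma ideal_mulr I a b : closed_ideal I -> I a -> I (a ** b).
Proof. by case=> _ _ _ _ h; exact: h. Qed.

Lemma ideal_sum I (T : eqType) (r : seq T) (F : T -> A) : closed_ideal I ->
  (forall i, i \in r -> I (F i)) -> I (\sum_(i <- r) F i).
Proof.
move=> hI H; rewrite big_seq; apply: big_ind => //; first exact: ideal0.
by move=> a b; exact: idealD.
Qed.

Lemma ideal_csubalg I : closed_ideal I -> closed_subalgebra I.
Proof. by case=> cI I0 lin _ h; split=> // a b Ia _; exact: h. Qed.

Lemma ideal_eq_of_mulr I a b : closed_ideal I -> I a -> I b ->
  (forall c, I c -> a ** c = b ** c) -> a = b.
Proof.
move=> hI Ia Ib H; have Iab := idealB hI Ia Ib.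
apply/eqP; rewrite -subr_eq0; apply/eqP/mul_cstar_eq0.
by rewrite {1}cmulBl H ?subrr//; exact: closed_ideal_star.
Qed.

(** Where a is the sum of an element of I and one of the annihilator of I, the
    former is b.  Testing a - b by multiplication keeps the annihilator out of
    the statements. *)
Definition ideal_component I a b := I b /\ forall c, I c -> a ** c = b ** c.

Section Fixed.
Variable I : set A.
Hypothesis hI : closed_ideal I.

Lemma icomp_uniq a b b' : ideal_component I a b -> ideal_component I a b' -> b = b'.
Proof.
move=> [Ib H] [Ib' H']; apply: (ideal_eq_of_mulr hI) => // c Ic.
by rewrite -H// H'.
Qed.

Lemma icomp_self a : I a -> ideal_component I a a. Proof. by []. Qed.

Lemma icomp_orthogonal a : (forall c, I c -> a ** c = 0) -> ideal_component I a 0.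
Proof. by move=> H; split=> [|c /H ->]; rewrite ?cmul0l//; exact: ideal0. Qed.

Lemma icomp_linear (k : R[i]) a b a' b' : ideal_component I a b -> ideal_component I a' b' ->
  ideal_component I (k *: a + a') (k *: b + b').
Proof.
move=> [Ib H] [Ib' H']; split; first by apply: idealD => //; exact: idealZ.
by move=> c Ic; rewrite !cmulDl !cmulZl H// H'.
Qed.

Lemma icompM a b a' b' : ideal_component I a b -> ideal_component I a' b' ->
  ideal_component I (a ** a') (b ** b').
Proof.
move=> [Ib H] [Ib' H']; split; first exact: ideal_mull.
by move=> c Ic; rewrite -!cmulA H'// H//; exact: ideal_mull.
Qed.

Lemma icomp_star a b : ideal_component I a b -> ideal_component I (cstar a) (cstar b).
Proof.
move=> [Ib H]; split; first exact: closed_ideal_star.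
move=> c Ic; apply/eqP; rewrite -subr_eq0 -cmulBl -cstarB; apply/eqP/cstar_mul_eq0.
by rewrite cstarM cstarK -cmulA cmulBl H ?subrr ?cmul0r//; exact: ideal_mull.
Qed.

(** b b* = a b*. *)
Lemma icomp_norm a b : ideal_component I a b -> `|b| <= `|a|.
Proof.
move=> [Ib H]; have [->|b0] := eqVneq b 0; first by rewrite normr0.
have nb0 : 0 < `|cstar b| by rewrite cnorm_cstar normr_gt0.
rewrite -(ler_pM2r nb0) {1}(cnorm_cstar b) -expr2 -cnorm_star_r.
by rewrite -H ?cnormM//; exact: closed_ideal_star.
Qed.

Lemma icomp_closed : closed [set a | exists b, ideal_component I a b].
Proof.
apply: contractive_dom_closed; [exact: icomp_linear|exact: icomp_norm|].
move=> a b H; split.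
  have [cI _ _ _ _] := hI; apply: (approx_closed cI) => e /H[a' [b' [[Ib' _] _ bb]]].
  by exists b'.
move=> c Ic; apply/eqP; rewrite -subr_eq0; apply/eqP/norm_small_eq0 => e e0.
have c1 : 0 < (`|c| + 1) * 2 by rewrite mulr_gt0// ltr_wpDl.
have [a' [b' [[Ib' H'] aa bb]]] := H _ (divr_gt0 e0 c1).
have -> : a ** c - b ** c = (a - a') ** c - (b - b') ** c.
  by rewrite !cmulBl H'// opprB addrA subrK.
have ec : e / ((`|c| + 1) * 2) * `|c| <= e / 2.
  have -> : e / ((`|c| + 1) * 2) * `|c| = e / 2 * (`|c| / (`|c| + 1)).
    by rewrite invfM; ring.
  rewrite ler_piMr ?divr_ge0 ?(ltW e0)//.
  by rewrite ler_pdivrMr ?ltr_wpDl// mul1r lerDl.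
rewrite (le_trans (ler_normB _ _))// [e]splitr lerD//.
  by rewrite (le_trans (cnormM _ _))// (le_trans _ ec)// ler_wpM2r.
by rewrite (le_trans (cnormM _ _))// (le_trans _ ec)// ler_wpM2r.
Qed.

End Fixed.
End IdealComponent.

Section OrthogonalSum.
Context {R : realType} {A : cstarAlgType R} {K : choiceType}.
Variables (J : K -> set A) (F : seq K).
Implicit Types (u v : K -> A).
Hypothesis hJ : forall i, i \in F -> closed_ideal (J i).
Hypothesis Jorth : forall i j a, i \in F -> j \in F -> i != j ->
  J i a -> J j a -> a = 0.
Hypothesis uF : uniq F.

Lemma orthogonal_sum_mul u v :
  (forall i, i \in F -> J i (u i)) -> (forall i, i \in F -> J i (v i)) ->
  (\sum_(i <- F) u i) ** (\sum_(i <- F) v i) = \sum_(i <- F) (u i ** v i).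
Proof.
move=> Ju Jv; rewrite cmul_suml; apply: eq_big_seq => i iF.
rewrite cmul_sumr (bigD1_seq i)//= big_seq_cond big1 ?addr0// => j /andP[jF ji].
apply: (@Jorth i j) => //; first by rewrite eq_sym.
  by apply: ideal_mulr; [exact: hJ|exact: Ju].
by apply: ideal_mull; [exact: hJ|exact: Jv].
Qed.

(** The certificates y i of |u i* u i| <= 1 in the sense of norm_le1_of_sub_sqr
    add up to one for the sum, because the ideals are orthogonal. *)
Lemma orthogonal_sum_norm_le1 u : (forall i, i \in F -> J i (u i)) ->
  (forall i, i \in F -> `|u i| <= 1) -> `|\sum_(i <- F) u i| <= 1.
Proof.
move=> Ju u1; set a := \sum_(i <- F) u i.
pose p i := cstar (u i) ** u i.
have Jp i : i \in F -> J i (p i) by move=> iF; apply: ideal_mull; [exact: hJ|exact: Ju].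
have aE : cstar a ** a = \sum_(i <- F) p i.
  rewrite /a cstar_sum orthogonal_sum_mul// => i iF.
  by apply: closed_ideal_star; [exact: hJ|exact: Ju].
have /choice[y Hy] i : exists y, i \in F ->
    [/\ cstar y = y, y + y - y ** y = p i ** p i, J i y & p i ** y = y ** p i].
  have [iF|_] := boolP (i \in F); last by exists 0.
  have [||y [sy yE _ Cy]] := @one_sub_sqrt _ _ (p i ** p i).
  - by rewrite cstarM /p cstar_sa_mul.
  - rewrite (le_trans (cnormM _ _))// mulr_ile1// cnorm_star exprn_ile1//; exact: u1.
  exists y => _; split => //.
    apply: (Cy _ (ideal_csubalg (hJ iF))); apply: ideal_mull; [exact: hJ|exact: Jp].
  by apply: (Cy _ (commutant_closed_subalgebra (p i))); rewrite /= cmulA.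
have Jy i : i \in F -> J i (y i) by move=> /Hy[].
rewrite -(ler_pXn2r (ltn0Sn 1)) ?nnegrE// expr1n -cnorm_star aE.
apply: (@norm_le1_of_sub_sqr _ _ _ (\sum_(i <- F) y i)).
- by rewrite cstar_sum; apply: eq_bigr => i _; exact: cstar_sa_mul.
- by rewrite cstar_sum; apply: eq_big_seq => i /Hy[].
- by rewrite !orthogonal_sum_mul//; apply: eq_big_seq => i /Hy[].
- rewrite !orthogonal_sum_mul// -big_split -sumrB; apply: eq_big_seq => i.
  by move=> /Hy[].
Qed.

Lemma orthogonal_sum_norm u (M : R[i]) : 0 < M -> (forall i, i \in F -> J i (u i)) ->
  (forall i, i \in F -> `|u i| <= M) -> `|\sum_(i <- F) u i| <= M.
Proof.
move=> M0 Ju uM; have := @orthogonal_sum_norm_le1 (fun i => M^-1 *: u i).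
rewrite -scaler_sumr normrZ gtr0_norm ?invr_gt0// ler_pdivrMl// mulr1; apply.
  by move=> i iF; apply: idealZ; [exact: hJ|exact: Ju].
by move=> i /uM ?; rewrite normrZ gtr0_norm ?invr_gt0// ler_pdivrMl// mulr1.
Qed.

End OrthogonalSum.

(** * Translates of tuples *)
Section TupleTranslates.
Context {G : groupType}.
Implicit Types (g h k : G) (t : {fset G}).

Lemma in_ltrans g t k : (k \in ltrans g t) = ((g^-1 * k)%g \in t).
Proof.
apply/imfsetP/idP => [[x /= xt ->]|kt]; first by rewrite mulKg.
by exists (g^-1 * k)%g; rewrite ?mulVKg.
Qed.

Lemma mem_ltrans g t k : ((g * k)%g \in ltrans g t) = (k \in t).
Proof. by rewrite in_ltrans mulKg. Qed.

Lemma ltrans1 t : ltrans 1%g t = t.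
Proof. by apply/fsetP => k; rewrite in_ltrans invg1 mul1g. Qed.

Lemma ltransM g h t : ltrans (g * h)%g t = ltrans g (ltrans h t).
Proof. by apply/fsetP => k; rewrite !in_ltrans invgM mulgA. Qed.

Lemma ltransK g t : ltrans g^-1%g (ltrans g t) = t.
Proof. by rewrite -ltransM mulVg ltrans1. Qed.

Lemma ltransVK g t : ltrans g (ltrans g^-1%g t) = t.
Proof. by rewrite -ltransM mulgV ltrans1. Qed.

Lemma card_ltrans g t : #|` ltrans g t| = #|` t|.
Proof. by rewrite card_imfset//=; exact: mulgI. Qed.

Variable n : nat.

Lemma tuples_ltrans g t : tuples n t -> g \in t -> tuples n (ltrans g^-1%g t).
Proof.
by move=> [_ tn] gt; split; rewrite ?card_ltrans// in_ltrans invgK mulg1.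
Qed.

Lemma inv_mem_ltrans g t : tuples n t -> g^-1%g \in ltrans g^-1%g t.
Proof. by move=> [t1 _]; rewrite in_ltrans mulVg. Qed.

Lemma tuples_neq t t' : tuples n t -> tuples n t' -> t != t' ->
  exists2 g, g \in t' & g \notin t.
Proof.
move=> [_ tn] [_ tn'] tt'; apply/fsubsetPn/negP => sub.
by case/negP: tt'; rewrite eq_sym eqEfcard sub tn tn' /=.
Qed.

End TupleTranslates.

(** * Partial actions *)
Section PartialActionBasics.
Context {R : realType} {G : groupType} {A : cstarAlgType R}.
Variable alpha : partialAction G A.
Implicit Types (g h k : G) (t : {fset G}) (a b c : A).
Local Notation D := (pdom alpha).

Lemma pact_dom g a : D g^-1%g a -> D g (alpha g a).
Proof. by case: (pact_iso alpha g) => -[h _ _] _ _ _; exact: h. Qed.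

Lemma pactK g a : D g^-1%g a -> alpha g^-1%g (alpha g a) = a.
Proof.
move=> Da; have [|_] := @pactM _ _ _ alpha g^-1%g g a Da.
  by rewrite invgK; exact: pact_dom.
by rewrite mulVg pact1.
Qed.

Lemma pactVK g a : D g a -> alpha g (alpha g^-1%g a) = a.
Proof. by move=> Da; rewrite -{1}(invgK g) pactK ?invgK. Qed.

Lemma pact_domV g a : D g a -> D g^-1%g (alpha g^-1%g a).
Proof. by move=> Da; apply: pact_dom; rewrite invgK. Qed.

Lemma pact_linear g (k : R[i]) a b : D g^-1%g a -> D g^-1%g b ->
  alpha g (k *: a + b) = k *: alpha g a + alpha g b.
Proof. by case: (pact_iso alpha g) => _ h _ _; exact: h. Qed.

Lemma pact_mul g a b : D g^-1%g a -> D g^-1%g b ->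
  alpha g (a ** b) = alpha g a ** alpha g b.
Proof. by case: (pact_iso alpha g) => _ _ h _; exact: h. Qed.

Lemma pact_star g a : D g^-1%g a -> alpha g (cstar a) = cstar (alpha g a).
Proof. by case: (pact_iso alpha g) => _ _ _ h; exact: h. Qed.

Lemma pact_0 g : alpha g 0 = 0.
Proof.
have D0 := ideal0 (pdom_ideal alpha g^-1%g).
by have := pact_linear (-1) D0 D0; rewrite scaler0 addr0 => ->; rewrite scaleN1r addNr.
Qed.

Lemma pactD g a b : D g^-1%g a -> D g^-1%g b ->
  alpha g (a + b) = alpha g a + alpha g b.
Proof. by move=> Da Db; rewrite -[a in LHS]scale1r pact_linear// scale1r. Qed.

Lemma pactZ g (k : R[i]) a : D g^-1%g a -> alpha g (k *: a) = k *: alpha g a.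
Proof.
move=> Da; rewrite -[k *: a]addr0 pact_linear ?pact_0 ?addr0//.
exact: ideal0 (pdom_ideal alpha _).
Qed.

Lemma pact_sum g (T : eqType) (r : seq T) (F : T -> A) :
  (forall i, i \in r -> D g^-1%g (F i)) ->
  alpha g (\sum_(i <- r) F i) = \sum_(i <- r) alpha g (F i).
Proof.
elim: r => [|i r IH] H; first by rewrite !big_nil pact_0.
have Hr j : j \in r -> D g^-1%g (F j) by move=> jr; apply: H; rewrite inE jr orbT.
rewrite !big_cons pactD ?IH//; first by apply: H; rewrite inE eqxx.
exact: ideal_sum (pdom_ideal alpha _) Hr.
Qed.

Lemma pact_norm_le g a : D g^-1%g a -> `|alpha g a| <= `|a|.
Proof.
apply: star_hom_contractive; first exact: pdom_ideal.
- by move=> k b c; exact: pact_linear.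
- by move=> b c; exact: pact_mul.
- by move=> b; exact: pact_star.
Qed.

(** a is alpha_h c with c = alpha_(h^-1) a, so alpha_g a = alpha_(g h) c. *)
Lemma pact_trans g h a : D g^-1%g a -> D h a -> D (g * h)%g (alpha g a).
Proof.
move=> Dg Dh; have Dc := pact_domV Dh; have cK := pactVK Dh.
have [|Dgh E] := @pactM _ _ _ alpha g h (alpha h^-1%g a) Dc; first by rewrite cK.
by rewrite -cK -E; exact: pact_dom.
Qed.

Lemma tideal_closed_ideal t : closed_ideal (tideal alpha t).
Proof.
have H g := pdom_ideal alpha g; split.
- by apply: closed_bigI => g _; case: (H g).
- by move=> g _; exact: ideal0.
- by move=> k a b Ia Ib g gt; case: (H g) => _ _ h _ _; apply: h; [exact: Ia|exact: Ib].
- by move=> a b Ib g gt; apply: ideal_mull => //; exact: Ib.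
- by move=> a b Ib g gt; apply: ideal_mulr => //; exact: Ib.
Qed.

Lemma tideal_pdom t g a : g \in t -> tideal alpha t a -> D g a.
Proof. by move=> gt; apply. Qed.

(** Since 1 is in t, the ideal A_(g^-1 t) is inside the domain of alpha_g. *)
Lemma pact_tideal g t a : 1%g \in t -> tideal alpha (ltrans g^-1%g t) a ->
  tideal alpha t (alpha g a).
Proof.
move=> t1 Ia h /= ht; rewrite -(mulVKg g h); apply: pact_trans.
  by apply: Ia; rewrite /= in_ltrans invgK mulgV.
by apply: Ia; rewrite /= mem_ltrans.
Qed.

End PartialActionBasics.

(** * Orbits of tuples and coset representatives *)
Section Orbits.
Context {G : groupType}.
Implicit Types (g h k : G) (s t u : {fset G}).
Variable n : nat.

Lemma orb_refl t : tuples n t -> orb t t.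
Proof. by move=> [t1 _]; exists 1%g; [exists 1%g; rewrite ?invg1|exact: ltrans1]. Qed.

Lemma orb_translate t s g : orb t s -> g \in s -> orb t (ltrans g^-1%g s).
Proof.
move=> [l [k kt <-] <-]; rewrite in_ltrans invgK => kgt.
by exists (k * g)^-1%g; [exists (k * g)%g|rewrite invgM ltransM].
Qed.

Lemma orb_sub t s : orb t s -> orb s `<=` orb t.
Proof. by move=> ts _ [_ [g gs <-] <-]; exact: orb_translate. Qed.

Lemma orb_tuples t s : tuples n t -> orb t s -> tuples n s.
Proof. by move=> tn [_ [g gt <-] <-]; exact: tuples_ltrans. Qed.

Lemma orb_sym t s : tuples n t -> orb t s -> orb s t.
Proof.
move=> tn [_ [k kt <-] <-]; exists k; last exact: ltransVK.
by exists k^-1%g; rewrite ?invgK//; exact: (inv_mem_ltrans _ tn).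
Qed.

Lemma orb_eq t s : tuples n t -> orb t s -> orb s = orb t.
Proof.
move=> tn ts; apply/seteqP; split; first exact: orb_sub.
by apply: orb_sub; exact: orb_sym.
Qed.

End Orbits.

Section CosetRepresentatives.
Context {G : groupType}.
Implicit Types (g h k : G).
Variables (n : nat) (t : {fset G}) (x : 'I_(mt n t).+1 -> G).
Hypotheses (tn : tuples n t) (hx : coset_reps x).
Local Notation m := (mt n t).

Lemma lstab1 : lstab t 1%g. Proof. exact: ltrans1. Qed.

Lemma lstabV h : lstab t h -> lstab t h^-1%g.
Proof. by move=> ht; rewrite /lstab /= -{1}ht ltransK. Qed.

Lemma lstab_mem h g : lstab t h -> ((h * g)%g \in t) = (g \in t).
Proof. by move=> ht; rewrite -{1}ht mem_ltrans. Qed.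

Lemma lstab_finite : finite_set (lstab t).
Proof.
apply: (@sub_finite_set _ _ [set` t]); last exact: finite_fset.
by move=> h ht /=; rewrite -(mulg1 h) lstab_mem//; case: tn.
Qed.

Lemma rep_mem j h : lstab t h -> (h * x j)%g \in t.
Proof.
move=> ht; have [_ tE _] := hx.
suff : [set` t] (h * x j)%g by [].
by rewrite tE; exists j => //; exists h.
Qed.

Lemma rep_in j : x j \in t.
Proof. by rewrite -(mul1g (x j)); apply: rep_mem; exact: lstab1. Qed.

Lemma rep_decomp g : g \in t -> exists j h, lstab t h /\ g = (h * x j)%g.
Proof.
move=> gt; have [_ tE _] := hx.
have : [set` t] g by [].
by rewrite tE => -[j _ [h ht <-]]; exists j, h.
Qed.

Lemma rep_inj i j h k : lstab t h -> lstab t k -> (h * x i)%g = (k * x j)%g -> i = j.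
Proof.
move=> hh hk E; have [_ _ tri] := hx; apply: tri => //.
by exists (h * x i)%g; split; [exists h|exists k; rewrite ?E].
Qed.

(** The elements of the orbit of t, each listed once; see orbP. *)
Definition orbit_tuple (j : 'I_m.+1) : {fset G} := ltrans (x j)^-1%g t.

Lemma orbit_tuple_tuples j : tuples n (orbit_tuple j).
Proof. by apply: tuples_ltrans => //; exact: rep_in. Qed.

Lemma orbit_tuple_orb j : orb t (orbit_tuple j).
Proof. by exists (x j)^-1%g => //; exists (x j) => //; exact: rep_in. Qed.

Lemma orbit_tuple_inj : injective orbit_tuple.
Proof.
move=> i j E; apply: (@rep_inj i j 1%g (x i * (x j)^-1)%g); first exact: lstab1.
  by rewrite /lstab /= ltransM -/(orbit_tuple j) -E ltransVK.
by rewrite mul1g mulgVK.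
Qed.

Lemma orbP s : orb t s -> exists j, s = orbit_tuple j.
Proof.
move=> [_ [g gt <-] <-]; have [j [h [ht ->]]] := rep_decomp gt.
exists j; rewrite invgM ltransM; congr ltrans; exact: lstabV.
Qed.

Lemma reps_perm :
  perm_eq [seq (h * x j)%g | j <- index_enum 'I_m.+1, h <- fset_set (lstab t)] t.
Proof.
have Hs h : (h \in fset_set (lstab t)) = (h \in lstab t).
  by rewrite in_fset_set//; exact: lstab_finite.
apply: uniq_perm; [|exact: fset_uniq|].
  apply: allpairs_uniq_dep; rewrite ?index_enum_uniq//; first by move=> j _; exact: fset_uniq.
  move=> _ _ /allpairsPdep[i [h [_ ht ->]]] /allpairsPdep[j [k [_ kt ->]]] /= E.
  rewrite !Hs !inE in ht kt; have ij := rep_inj ht kt E; subst j.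
  by move: E => /mulIg ->.
move=> g; apply/allpairsPdep/idP => [[j [h [_ ht ->]]]|gt].
  by apply: rep_mem; rewrite Hs inE in ht.
have [j [h [ht ->]]] := rep_decomp gt; exists j, h; split; rewrite ?mem_index_enum//.
by rewrite Hs inE.
Qed.

Lemma sum_reps (V : zmodType) (F : G -> V) :
  \sum_j \sum_(h \in lstab t) F (h * x j)%g = \sum_(g <- t) F g.
Proof.
rewrite -(perm_big _ reps_perm) big_allpairs_dep /=; apply: eq_bigr => j _.
by rewrite fsbig_finite//; exact: lstab_finite.
Qed.

Lemma card_reps : n = (m.+1 * lstab_card t)%N.
Proof.
have /perm_size := reps_perm; rewrite size_allpairs => E.
have [_ tE] := tn; transitivity #|` t|; first by rewrite tE.
by rewrite -E -sum1_size sum1_card card_ord.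
Qed.

End CosetRepresentatives.

(** * The components of the direct sum decomposition *)
Section Components.
Context {R : realType} {G : groupType} {A : cstarAlgType R}.
Variables (alpha : partialAction G A) (n : nat).
Hypothesis dec : decomposition_property alpha n.
Implicit Types (g h k : G) (t : {fset G}) (a b c : A).
Local Notation D := (pdom alpha).
Local Notation T := (tideal alpha).
Local Notation hT := (tideal_closed_ideal alpha).

Lemma tideal_pdom_disjoint t g a : tuples n t -> g \notin t -> T t a -> D g a -> a = 0.
Proof.
move=> tn gt Ta Da; have [_ H] := dec.
by have : (T t `&` D g) a by []; rewrite H.
Qed.

Lemma tideal_disjoint t t' a : tuples n t -> tuples n t' -> t != t' ->
  T t a -> T t' a -> a = 0.
Proof.
move=> tn tn' tt' Ta Ta'; have [g gt' gt] := tuples_neq tn tn' tt'.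
by apply: (tideal_pdom_disjoint tn gt) => //; exact: Ta'.
Qed.

Lemma decomposition_ind (P : set A) : closed P -> P 0 ->
  (forall a b, P a -> P b -> P (a + b)) ->
  (forall t a, tuples n t -> T t a -> P a) -> forall a, P a.
Proof.
move=> cP P0 PD PT a; apply: (approx_closed cP) => e e0.
have [dense _] := dec.
have /closure_approx/(_ _ e0)[s Ss sa] : closure (subspace_sum (tuples n) T) a.
  by rewrite dense.
exists s => //; have [F [f [Ff ->]]] := Ss.
rewrite big_seq; apply: big_ind => // t tF.
by have [tn Tf] := Ff t tF; exact: PT tn Tf.
Qed.

Definition tcomp t a : A := xget 0 [set b | ideal_component (T t) a b].

Lemma tcompP t a : tuples n t -> ideal_component (T t) a (tcomp t a).
Proof.
move=> tn; suff : exists b, ideal_component (T t) a b.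
  by move=> [b hb]; rewrite /tcomp; case: xgetP => [c _ //|/(_ b)].
move: a; apply: decomposition_ind.
- exact: icomp_closed (hT t).
- by exists 0; apply: icomp_self; exact: ideal0 (hT t).
- move=> a b [a' ha] [b' hb]; exists (a' + b').
  by rewrite -[a]scale1r -[a']scale1r; exact: icomp_linear (hT t) _ _ _ _ _ ha hb.
- move=> t' a tn' Ta; have [<-|tt'] := eqVneq t' t.
    by exists a; exact: icomp_self.
  exists 0; apply: icomp_orthogonal => [|c Tc]; first exact: hT.
  apply: (tideal_disjoint tn' tn tt'); first exact: ideal_mulr (hT t') Ta.
  exact: ideal_mull (hT t) Tc.
Qed.

Lemma tcompE t a b : tuples n t -> ideal_component (T t) a b -> tcomp t a = b.
Proof. by move=> tn; apply: icomp_uniq; [exact: hT|exact: tcompP]. Qed.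

Lemma tcomp_in t a : tuples n t -> T t (tcomp t a).
Proof. by move=> /(tcompP a)[]. Qed.

Lemma tcomp_linear t (k : R[i]) a b : tuples n t ->
  tcomp t (k *: a + b) = k *: tcomp t a + tcomp t b.
Proof.
move=> tn; apply: tcompE => //.
by apply: icomp_linear; [exact: hT|exact: tcompP|exact: tcompP].
Qed.

Lemma tcomp_id t a : tuples n t -> T t a -> tcomp t a = a.
Proof. by move=> tn Ta; apply: tcompE => //; exact: icomp_self. Qed.

Lemma tcomp0 t : tuples n t -> tcomp t 0 = 0.
Proof. by move=> tn; apply: tcomp_id => //; exact: ideal0 (hT t). Qed.

Lemma tcompD t a b : tuples n t -> tcomp t (a + b) = tcomp t a + tcomp t b.
Proof. by move=> tn; rewrite -[a in LHS]scale1r tcomp_linear// scale1r. Qed.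

Lemma tcompZ t (k : R[i]) a : tuples n t -> tcomp t (k *: a) = k *: tcomp t a.
Proof. by move=> tn; rewrite -[k *: a in LHS]addr0 tcomp_linear// tcomp0// addr0. Qed.

Lemma tcompB t a b : tuples n t -> tcomp t (a - b) = tcomp t a - tcomp t b.
Proof. by move=> tn; rewrite tcompD// -scaleN1r tcompZ// scaleN1r. Qed.

Lemma tcomp_sum t (I : Type) (r : seq I) (P : pred I) (F : I -> A) : tuples n t ->
  tcomp t (\sum_(i <- r | P i) F i) = \sum_(i <- r | P i) tcomp t (F i).
Proof.
by move=> tn; apply: (big_morph (tcomp t)) => [a b|]; [exact: tcompD|exact: tcomp0].
Qed.

Lemma tcompM t a b : tuples n t -> tcomp t (a ** b) = tcomp t a ** tcomp t b.
Proof.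
move=> tn; apply: tcompE => //.
by apply: icompM; [exact: hT|exact: tcompP|exact: tcompP].
Qed.

Lemma tcomp_star t a : tuples n t -> tcomp t (cstar a) = cstar (tcomp t a).
Proof. by move=> tn; apply: tcompE => //; apply: icomp_star; [exact: hT|exact: tcompP]. Qed.

Lemma tcomp_norm t a : tuples n t -> `|tcomp t a| <= `|a|.
Proof. by move=> tn; apply: icomp_norm (tcompP a tn); exact: hT. Qed.

(** The product of A_g and A_t is in their intersection, which is 0. *)
Lemma tcomp_pdom_eq0 t g a : tuples n t -> g \notin t -> D g a -> tcomp t a = 0.
Proof.
move=> tn gt Da; apply: tcompE => //; apply: icomp_orthogonal => [|c Tc]; first exact: hT.
apply: (tideal_pdom_disjoint tn gt); first exact: ideal_mull (hT t) Tc.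
exact: ideal_mulr (pdom_ideal alpha g) Da.
Qed.

Lemma tcomp_other t t' a : tuples n t -> tuples n t' -> t' != t -> T t' a ->
  tcomp t a = 0.
Proof.
move=> tn tn' tt' Ta; have [|g gt' gt] := tuples_neq tn tn' _; first by rewrite eq_sym.
by apply: (tcomp_pdom_eq0 tn gt); exact: Ta.
Qed.

(** This holds for finite sums by orthogonality, and it passes to limits because
    taking components is contractive. *)
Lemma norm_le_tcomp a (M : R[i]) : 0 <= M ->
  (forall t, tuples n t -> `|tcomp t a| <= M) -> `|a| <= M.
Proof.
move=> M0 H; apply: le_of_le_eps => [| |e e0]; rewrite ?normr_real ?ger0_real//.
have [dense _] := dec.
have /closure_approx/(_ _ (divr_gt0 e0 (ltr0n _ 2)))[s Ss sa] :
  closure (subspace_sum (tuples n) T) a by rewrite dense.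
have [F [f [Ff sE]]] := Ss.
have fE t : t \in F -> f t = tcomp t s.
  move=> tF; have [tn Tf] := Ff t tF; rewrite sE tcomp_sum// (bigD1_seq t tF (fset_uniq F))/=.
  rewrite tcomp_id// big_seq_cond big1 ?addr0// => t' /andP[/Ff[tn' Tf'] tt'].
  exact: tcomp_other Tf'.
have sM : `|s| <= M + e / 2.
  rewrite sE; apply: (@orthogonal_sum_norm _ _ _ T).
  - by move=> i _; exact: hT.
  - by move=> i j b /Ff[ni _] /Ff[nj _]; exact: tideal_disjoint.
  - exact: fset_uniq.
  - by rewrite ltr_wpDl// divr_gt0.
  - by move=> i /Ff[].
  - move=> i iF; have [tn _] := Ff i iF; rewrite fE//.
    rewrite -(subrK (tcomp i a) (tcomp i s)) (le_trans (ler_normD _ _))//.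
    rewrite addrC lerD ?H// -tcompB// (le_trans (tcomp_norm _ tn))//.
    by rewrite distrC.
rewrite -(subrK s a) (le_trans (ler_normD _ _))//.
by rewrite [e]splitr addrA addrC lerD.
Qed.

Lemma tcomp_ext a b : (forall t, tuples n t -> tcomp t a = tcomp t b) -> a = b.
Proof.
move=> H; apply/eqP; rewrite -subr_eq0 -normr_le0; apply: norm_le_tcomp => // t tn.
by rewrite tcompB// H// subrr normr0.
Qed.

Lemma tcomp_pact t g a : tuples n t -> g \in t -> D g^-1%g a ->
  tcomp t (alpha g a) = alpha g (tcomp (ltrans g^-1%g t) a).
Proof.
move=> tn gt Da; have tn' := tuples_ltrans tn gt; have [t1 _] := tn.
have Dg b : T (ltrans g^-1%g t) b -> D g^-1%g b.
  by apply: tideal_pdom; exact: inv_mem_ltrans.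
have Ta := tcomp_in a tn'.
apply: tcompE => //; split; first exact: pact_tideal.
move=> c Tc; have Dc : D g c by exact: Tc.
have Tc' : T (ltrans g^-1%g t) (alpha g^-1%g c).
  by apply: pact_tideal; [case: tn'|rewrite invgK ltransVK].
rewrite -(pactVK Dc) -!pact_mul; [|exact: Dg..| |exact: Dg] => //.
by have [_ ->] := tcompP a tn'.
Qed.

(** * The averaging map *)
Hypothesis n_gt0 : (0 < n)%N.

(** The component that the average of a is to have in A_t. *)
Definition avg t a : A :=
  n%:R^-1 *: \sum_(g <- t) alpha g (tcomp (ltrans g^-1%g t) a).

Lemma tcomp_translate_pdom t g a : tuples n t -> g \in t ->
  D g^-1%g (tcomp (ltrans g^-1%g t) a).
Proof.
move=> tn gt; apply: (tideal_pdom (inv_mem_ltrans _ tn)).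
exact: tcomp_in (tuples_ltrans tn gt).
Qed.

Lemma tcomp_translate_in t g a : tuples n t -> g \in t ->
  T t (alpha g (tcomp (ltrans g^-1%g t) a)).
Proof.
move=> tn gt; apply: pact_tideal; first by case: tn.
exact: tcomp_in (tuples_ltrans tn gt).
Qed.

Lemma avg_linear t (k : R[i]) a b : tuples n t ->
  avg t (k *: a + b) = k *: avg t a + avg t b.
Proof.
move=> tn; rewrite /avg scalerA mulrC -scalerA -scalerDr; congr (_ *: _).
rewrite scaler_sumr -big_split; apply: eq_big_seq => g gt; have tn' := tuples_ltrans tn gt.
by rewrite tcomp_linear// pact_linear//; exact: tcomp_translate_pdom.
Qed.

Lemma avg_norm_le t a (M : R[i]) : tuples n t ->
  (forall g, g \in t -> `|tcomp (ltrans g^-1%g t) a| <= M) -> `|avg t a| <= M.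
Proof.
move=> tn H; rewrite /avg normrZ normfV normr_nat ler_pdivrMl ?ltr0n//.
apply: le_trans (ler_norm_sum _ _ _) _.
have -> : n%:R * M = \sum_(g <- t) M.
  by rewrite big_const_seq count_predT iter_addr_0 mulr_natl; case: tn => _ ->.
rewrite big_seq [leRHS]big_seq; apply: ler_sum => g gt.
by rewrite (le_trans (pact_norm_le _))//; [exact: tcomp_translate_pdom|exact: H].
Qed.

Lemma avg_norm t a : tuples n t -> `|avg t a| <= `|a|.
Proof.
move=> tn; apply: avg_norm_le => // g gt; apply: tcomp_norm => //.
exact: tuples_ltrans.
Qed.

Definition is_average a e := forall t, tuples n t -> tcomp t e = avg t a.

Lemma is_average_linear (k : R[i]) a b a' b' : is_average a b -> is_average a' b' ->
  is_average (k *: a + a') (k *: b + b').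
Proof. by move=> H H' t tn; rewrite tcomp_linear// avg_linear// H// H'. Qed.

Lemma is_average_norm a e : is_average a e -> `|e| <= `|a|.
Proof.
by move=> H; apply: norm_le_tcomp => // t tn; rewrite H//; exact: avg_norm.
Qed.

Lemma is_average_closed : closed [set a | exists e, is_average a e].
Proof.
apply: contractive_dom_closed; [exact: is_average_linear|exact: is_average_norm|].
move=> a b H t tn; apply/eqP; rewrite -subr_eq0; apply/eqP/norm_small_eq0 => e e0.
have [a' [b' [ab' aa bb]]] := H _ (divr_gt0 e0 (ltr0n _ 2)).
rewrite -(subrKA (tcomp t b')) [e]splitr (le_trans (ler_normD _ _))// lerD//.
  by rewrite -tcompB// (le_trans (tcomp_norm _ tn)).
rewrite ab'// -scaleN1r addrC -avg_linear// scaleN1r addrC.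
by rewrite (le_trans (avg_norm _ tn))// distrC.
Qed.

(** The component at s of the right side comes from those g for which
    alpha_(g^-1) a is in A_s, that is, g^-1 t = s; the component demanded by
    avg comes from those k in s for which k^-1 s = t.  These correspond under
    k = g^-1. *)
Lemma is_average_tideal t a : tuples n t -> T t a ->
  is_average a (n%:R^-1 *: \sum_(g <- t) alpha g^-1%g a).
Proof.
move=> tn Ta s sn; rewrite tcompZ// tcomp_sum//; congr (_ *: _).
pose F k := alpha k (tcomp (ltrans k^-1%g s) a).
rewrite (bigID (fun g => g^-1%g \in s))/= [X in _ + X]big_seq_cond.
rewrite [X in _ + X]big1 ?addr0 => [|g /andP[gt gs]]; last first.
  apply: (tcomp_pdom_eq0 sn gs); apply: pact_domV; exact: Ta.
transitivity (\sum_(g <- t | g^-1%g \in s) F g^-1%g).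
  rewrite big_seq_cond [RHS]big_seq_cond; apply: eq_bigr => g /andP[gt gs].
  by apply: tcomp_pact => //; rewrite invgK; exact: Ta.
rewrite [RHS](bigID (fun g => g^-1%g \in t))/= [X in _ = _ + X]big_seq_cond.
rewrite [X in _ = _ + X]big1 ?addr0 => [|g /andP[gs gt]]; last first.
  rewrite (@tcomp_other _ t) ?pact_0//; first exact: (tuples_ltrans sn gs).
  by apply: contraNN gt => /eqP ->; exact: (inv_mem_ltrans _ sn).
rewrite -(big_filter _ (fun g => g^-1%g \in s)) -[RHS]big_filter.
rewrite -(big_map (fun g => g^-1%g) xpredT F); apply: perm_big.
apply: uniq_perm.
- by rewrite map_inj_uniq ?filter_uniq ?fset_uniq//; exact: invg_inj.
- by rewrite filter_uniq ?fset_uniq.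
move=> g; rewrite mem_filter; apply/mapP/andP => [[h]|[gt gs]].
  by rewrite mem_filter => /andP[hs ht] ->; rewrite invgK.
by exists g^-1%g; rewrite ?invgK// mem_filter invgK gs gt.
Qed.

Lemma average_exists a : exists e, is_average a e.
Proof.
move: a; apply: decomposition_ind; first exact: is_average_closed.
- exists 0 => t tn; rewrite tcomp0// /avg big_seq big1 ?scaler0// => g gt.
  by rewrite tcomp0 ?pact_0//; exact: tuples_ltrans.
- move=> a b [a' ha] [b' hb]; exists (a' + b').
  by rewrite -[a]scale1r -[a']scale1r; exact: is_average_linear.
- by move=> t a tn Ta; eexists; exact: is_average_tideal Ta.
Qed.

(** The conditional expectation of A onto its fixed point algebra. *)
Definition average a : A := xget 0 [set e | is_average a e].

Lemma averageP a : is_average a (average a).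
Proof.
rewrite /average; case: xgetP => [c _ //|H].
by have [e he] := average_exists a; case: (H e).
Qed.

Lemma averageE a e : is_average a e -> average a = e.
Proof. by move=> H; apply: tcomp_ext => t tn; rewrite averageP// H. Qed.

Lemma average_linear (k : R[i]) a b : average (k *: a + b) = k *: average a + average b.
Proof. by apply: averageE; apply: is_average_linear; exact: averageP. Qed.

Lemma averageD a b : average (a + b) = average a + average b.
Proof. by rewrite -[a in LHS]scale1r average_linear scale1r. Qed.

Lemma average0 : average 0 = 0.
Proof. by apply: (addrI (average 0)); rewrite -averageD !addr0. Qed.

Lemma averageZ (k : R[i]) a : average (k *: a) = k *: average a.
Proof. by rewrite -[k *: a]addr0 average_linear average0 addr0. Qed.

Lemma averageB a b : average (a - b) = average a - average b.
Proof. by rewrite averageD -scaleN1r averageZ scaleN1r. Qed.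

Lemma average_sum (I : Type) (r : seq I) (P : pred I) (F : I -> A) :
  average (\sum_(i <- r | P i) F i) = \sum_(i <- r | P i) average (F i).
Proof. by apply: (big_morph average) => [a b|]; [exact: averageD|exact: average0]. Qed.

Lemma average_norm a : `|average a| <= `|a|.
Proof. exact: is_average_norm (averageP a). Qed.

(** By fixed_supportedE this characterizes the fixed points. *)
Definition equivariant a := forall t g, tuples n t -> g \in t ->
  alpha g (tcomp (ltrans g^-1%g t) a) = tcomp t a.

(** alpha_g permutes the summands: alpha_g alpha_h = alpha_(g h) on them, and
    h in g^-1 t corresponds to g h in t. *)
Lemma average_equivariant a : equivariant (average a).
Proof.
move=> t g tn gt; have tn' := tuples_ltrans tn gt.
rewrite !averageP// /avg pactZ; last first.
  apply: ideal_sum (pdom_ideal alpha _) _ => h ht.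
  exact: (tideal_pdom (inv_mem_ltrans _ tn)) (tcomp_translate_in _ tn' ht).
congr (_ *: _); rewrite pact_sum => [|h ht]; last first.
  exact: (tideal_pdom (inv_mem_ltrans _ tn)) (tcomp_translate_in _ tn' ht).
transitivity (\sum_(h <- ltrans g^-1%g t) alpha (g * h)%g (tcomp (ltrans (g * h)^-1%g t) a)).
  apply: eq_big_seq => h ht; rewrite invgM ltransM.
  have Dh := tcomp_translate_pdom a tn' ht.
  have [|_ ->//] := @pactM _ _ _ alpha g h _ Dh.
  exact: (tideal_pdom (inv_mem_ltrans _ tn)) (tcomp_translate_in _ tn' ht).
rewrite -(big_map (fun h => (g * h)%g) xpredT (fun k => alpha k (tcomp (ltrans k^-1%g t) a))).
apply: perm_big; apply: uniq_perm; rewrite ?fset_uniq//.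
  by rewrite map_inj_uniq ?fset_uniq//; exact: mulgI.
move=> k; apply/mapP/idP => [[h ht ->]|kt].
  by rewrite in_ltrans invgK in ht.
by exists (g^-1 * k)%g; rewrite ?mem_ltrans// mulVKg.
Qed.

Lemma average_id a : equivariant a -> average a = a.
Proof.
move=> H; apply: averageE => t tn; rewrite /avg (eq_big_seq (fun=> tcomp t a)); last first.
  by move=> g gt; exact: H.
rewrite big_const_seq count_predT iter_addr_0; case: (tn) => _ ->.
by rewrite -[tcomp t a *+ n]scaler_nat scalerA mulVf ?scale1r// pnatr_eq0 -lt0n.
Qed.

Lemma average_mul_equivariant_l a b : equivariant b -> average (b ** a) = b ** average a.
Proof.
move=> H; apply: averageE => t tn; rewrite tcompM// averageP// /avg cmulZr cmul_sumr.
congr (_ *: _); apply: eq_big_seq => g gt; have tn' := tuples_ltrans tn gt.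
by rewrite tcompM// pact_mul ?H//; exact: tcomp_translate_pdom.
Qed.

Lemma average_mul_equivariant_r a b : equivariant b -> average (a ** b) = average a ** b.
Proof.
move=> H; apply: averageE => t tn; rewrite tcompM// averageP// /avg cmulZl cmul_suml.
congr (_ *: _); apply: eq_big_seq => g gt; have tn' := tuples_ltrans tn gt.
by rewrite tcompM// pact_mul ?H//; exact: tcomp_translate_pdom.
Qed.

Lemma tcomp_translate_star_mul t g c : tuples n t -> g \in t ->
  alpha g (tcomp (ltrans g^-1%g t) (cstar c ** c)) =
  cstar (alpha g (tcomp (ltrans g^-1%g t) c)) ** alpha g (tcomp (ltrans g^-1%g t) c).
Proof.
move=> tn gt; have tn' := tuples_ltrans tn gt.
have Dc := tcomp_translate_pdom c tn gt.
rewrite tcompM// tcomp_star// pact_mul// ?pact_star//.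
by apply: closed_ideal_star => //; exact: pdom_ideal.
Qed.

Lemma ninv_gt0 : 0 < n%:R^-1 :> R[i]. Proof. by rewrite invr_gt0 ltr0n. Qed.

Lemma avg_star_mul_cpos t c : tuples n t -> cpos (avg t (cstar c ** c)).
Proof.
move=> tn; rewrite /avg; apply: (cposZ ninv_gt0); rewrite big_seq; apply: cpos_sum.
by move=> g gt; rewrite tcomp_translate_star_mul//; exact: star_mul_cpos.
Qed.

Lemma tcomp_sum_tideal (F : {fset {fset G}}) (f : {fset G} -> A) t :
  (forall s, s \in F -> tuples n s /\ T s (f s)) -> tuples n t ->
  tcomp t (\sum_(s <- F) f s) = if t \in F then f t else 0.
Proof.
move=> Ff tn; rewrite tcomp_sum//; have [tF|tF] := boolP (t \in F).
  rewrite (bigD1_seq t tF (fset_uniq F))/= tcomp_id//; last by case: (Ff t tF).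
  rewrite big_seq_cond big1 ?addr0// => s /andP[/Ff[sn Ts] ts].
  exact: tcomp_other ts Ts.
rewrite big_seq big1// => s sF; have [sn Ts] := Ff s sF.
by apply: tcomp_other Ts => //; apply: contraNneq tF => <-.
Qed.

(** This takes the place of the c_0 condition: a finite sum near a has only the
    components in F, so the others are small for a. *)
Lemma tcomp_truncation a (e : R[i]) : 0 < e -> exists2 F : {fset {fset G}},
  (forall t, t \in F -> tuples n t) &
  forall b, (forall t, tuples n t ->
     tcomp t b = tcomp t a \/ (t \notin F /\ tcomp t b = 0)) -> `|a - b| <= e.
Proof.
move=> e0; have [dense _] := dec.
have /closure_approx/(_ _ e0)[s Ss sa] : closure (subspace_sum (tuples n) T) a.
  by rewrite dense.
have [F [f [Ff sE]]] := Ss; exists F => [t /Ff[]//|b H].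
apply: norm_le_tcomp => [|t tn]; first exact: ltW.
rewrite tcompB//; have [->|[tF ->]] := H t tn; first by rewrite subrr normr0 ltW.
have -> : tcomp t a - 0 = tcomp t (a - s).
  by rewrite tcompB// sE tcomp_sum_tideal// (negbTE tF).
exact: le_trans (tcomp_norm _ tn) sa.
Qed.

Lemma cpos_tcomp a : (forall t, tuples n t -> cpos (tcomp t a)) -> cpos a.
Proof.
move=> H; apply: (approx_closed (@cpos_closed _ A)) => e e0.
have [F Fn HF] := tcomp_truncation a e0.
exists (\sum_(t <- F) tcomp t a).
  by rewrite big_seq; apply: cpos_sum => t /Fn; exact: H.
apply: HF => t tn; rewrite tcomp_sum_tideal//; last first.
  by move=> s /Fn sn; split => //; exact: tcomp_in.
by case: ifPn => tF; [left|right].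
Qed.

Lemma average_star_mul_cpos c : cpos (average (cstar c ** c)).
Proof.
by apply: cpos_tcomp => t tn; rewrite averageP//; exact: avg_star_mul_cpos.
Qed.

(** In the component at t, the summand of g = 1 is that of c* c itself; a sum of
    positive elements vanishes only if they all do. *)
Lemma average_faithful c : average (cstar c ** c) = 0 -> cstar c ** c = 0.
Proof.
move=> H; apply: tcomp_ext => t tn; rewrite tcomp0//.
have := averageP (cstar c ** c) tn; rewrite H tcomp0// /avg => /esym/eqP.
rewrite scaler_eq0 (gt_eqF ninv_gt0)/= => /eqP.
have [t1 _] := tn; rewrite (bigD1_seq 1%g t1 (fset_uniq t))/=.
have E : alpha 1%g (tcomp (ltrans 1^-1%g t) (cstar c ** c)) = tcomp t (cstar c ** c).
  by rewrite pact1 invg1 ltrans1.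
rewrite E; apply: cpos_add_eq0.
  by rewrite -E tcomp_translate_star_mul//; exact: star_mul_cpos.
rewrite big_seq_cond; apply: cpos_sum => g /andP[gt _].
by rewrite tcomp_translate_star_mul//; exact: star_mul_cpos.
Qed.

(** The fixed points are the equalizer of two contractive maps; so they form a
    closed subspace. *)
Lemma equivariantP a : equivariant a <-> average a = a.
Proof.
by split=> [|<-]; [exact: average_id|exact: average_equivariant].
Qed.

Lemma equivariant_csubalg : cstar_subalgebra equivariant.
Proof.
have nA a b : `|average a - average b| <= 1 * `|a - b|.
  by rewrite -averageB mul1r average_norm.
have nI a b : `|a - b| <= 1 * `|a - b| by rewrite mul1r.
split.
- have -> : equivariant = [set a | average a = a].
    by apply/seteqP; split=> a /equivariantP.
  exact: closed_eq_bounded ltr01 nA nI.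
- by apply/equivariantP; exact: average0.
- move=> k a b /equivariantP Ea /equivariantP Eb; apply/equivariantP.
  by rewrite average_linear Ea Eb.
- move=> a b Ea /equivariantP Eb; apply/equivariantP.
  by rewrite average_mul_equivariant_l// Eb.
- move=> a Ea t g tn gt; rewrite !tcomp_star//; last exact: tuples_ltrans.
  by rewrite pact_star ?Ea//; exact: tcomp_translate_pdom.
Qed.

(** For S the orbit of t this is the ideal A_(G.t), see orbit_idealE; for S the
    set of all tuples it is A. *)
Definition supported S : set A :=
  [set a | forall t, tuples n t -> ~ S t -> tcomp t a = 0].

Lemma supported_ideal S : closed_ideal (supported S).
Proof.
split.
- apply: closed_of_approx => a H t tn St; apply: norm_small_eq0 => e /H[s Ss sa].
  by rewrite -[tcomp t a]subr0 -(Ss t)// -tcompB// (le_trans (tcomp_norm _ tn)).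
- by move=> t tn _; rewrite tcomp0.
- by move=> k a b Ha Hb t tn St; rewrite tcomp_linear// Ha// Hb// scaler0 addr0.
- by move=> a b Hb t tn St; rewrite tcompM// Hb// cmul0r.
- by move=> a b Ha t tn St; rewrite tcompM// Ha// cmul0l.
Qed.

Lemma tideal_supported S t a : tuples n t -> S t -> T t a -> supported S a.
Proof.
by move=> tn St Ta s sn Ss; apply: tcomp_other Ta => //; apply: contra_notN Ss => /eqP <-.
Qed.

Lemma closed_ideal_csubalg (I : set A) : closed_ideal I -> cstar_subalgebra I.
Proof.
move=> hI; have [cI I0 lin _ mr] := hI; split => //; first by move=> a b Ia _; exact: mr.
by move=> a; exact: closed_ideal_star.
Qed.

(** * The expectation on elements supported on an invariant family *)
Section Support.
Variable S : set {fset G}.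
Hypothesis Sinv : forall t g, tuples n t -> S t -> g \in t -> S (ltrans g^-1%g t).

Lemma translate_notin t g : tuples n t -> g \in t -> ~ S t -> ~ S (ltrans g^-1%g t).
Proof.
move=> tn gt St H; apply: St; rewrite -(ltransVK g t) -{1}(invgK g).
by apply: Sinv => //; [exact: tuples_ltrans|exact: inv_mem_ltrans tn].
Qed.

Lemma average_supported a : supported S a -> supported S (average a).
Proof.
move=> Sa t tn St; rewrite averageP// /avg big_seq big1 ?scaler0// => g gt.
by rewrite Sa ?pact_0//; [exact: tuples_ltrans|exact: translate_notin].
Qed.

(** From left to right, test the fixed point identity on b in A_(g^-1 t), on which
    multiplication by a and by its component agree.  Conversely the identity is
    checked in each component: where g^-1 is not in t both sides vanish, and
    elsewhere alpha_(g^-1) can be applied to components. *)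
Lemma fixed_supportedE :
  fixed_algebra alpha (supported S) = supported S `&` equivariant.
Proof.
apply/seteqP; split=> a [Sa Ha]; split => //.
  move=> t g tn gt; have tn' := tuples_ltrans tn gt.
  have [St|St] := pselect (S t); last first.
    by rewrite !Sa ?pact_0//; exact: translate_notin.
  apply: (ideal_eq_of_mulr (hT t)); [exact: tcomp_translate_in|exact: tcomp_in|].
  move=> c Tc; have Dc : D g c by exact: Tc.
  have Tc' : T (ltrans g^-1%g t) (alpha g^-1%g c).
    by apply: pact_tideal; [case: tn'|rewrite invgK ltransVK].
  have Dc' := pact_domV Dc.
  have := Ha g^-1%g (alpha g^-1%g c); rewrite invgK pactVK// => H.
  have [_ <-//] := tcompP a tn; rewrite -H; last first.
    by split=> //; apply: tideal_supported Tc' => //; exact: Sinv.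
  have [_ ->//] := tcompP a tn'.
  by rewrite pact_mul ?pactVK//; exact: tcomp_translate_pdom.
move=> g b [_ Db]; have Dab : D g (a ** b) by exact: ideal_mull (pdom_ideal alpha g) Db.
apply: tcomp_ext => t tn; rewrite tcompM//.
have [gt|gt] := boolP (g^-1%g \in t); last first.
  rewrite (tcomp_pdom_eq0 tn gt (pact_domV Dab)).
  by rewrite (tcomp_pdom_eq0 tn gt (pact_domV Db)) cmul0r.
have tn' := tuples_ltrans tn gt.
have Dab' : D g^-1^-1%g (a ** b) by rewrite invgK.
have Db' : D g^-1^-1%g b by rewrite invgK.
rewrite (tcomp_pact tn gt Dab') (tcomp_pact tn gt Db') tcompM//.
by rewrite pact_mul ?Ha//; exact: tcomp_translate_pdom.
Qed.

Lemma faithful_cond_expectation_average :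
  faithful_cond_expectation (supported S) (fixed_algebra alpha (supported S)) average.
Proof.
have csS := closed_ideal_csubalg (supported_ideal S).
have csF : cstar_subalgebra (fixed_algebra alpha (supported S)).
  rewrite fixed_supportedE; have [c1 z1 l1 m1 s1] := csS.
  have [c2 z2 l2 m2 s2] := equivariant_csubalg.
  split=> //; first exact: closedI.
  - by move=> k a b [? ?] [? ?]; split; [exact: l1|exact: l2].
  - by move=> a b [? ?] [? ?]; split; [exact: m1|exact: m2].
  - by move=> a [? ?]; split; [exact: s1|exact: s2].
split; last by move=> _ [c _ ->]; exact: average_faithful.
split=> //.
- by move=> a [].
- move=> a Sa; rewrite fixed_supportedE; split; first exact: average_supported.
  exact: average_equivariant.
- by move=> b; rewrite fixed_supportedE => -[_ /equivariantP].
- by move=> k a b _ _; exact: average_linear.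
- move=> _ [c Sc ->]; have [cF F0 lF mF _] := csF.
  have hF : closed_subalgebra (fixed_algebra alpha (supported S)) by [].
  have [|s [ss sE Fs]] := cpos_sqrt hF (average_star_mul_cpos c).
    rewrite fixed_supportedE; split; last exact: average_equivariant.
    by apply: average_supported; exact: ideal_mull (supported_ideal S) Sc.
  by exists s => //; rewrite ss sE.
- by move=> a _; exact: average_norm.
- by move=> b a; rewrite fixed_supportedE => -[_ Hb] _; exact: average_mul_equivariant_l.
- by move=> a b _; rewrite fixed_supportedE => -[_ Hb]; exact: average_mul_equivariant_r.
Qed.

End Support.

(** * A single orbit *)
Lemma orb_invariant t0 t g : tuples n t -> orb t0 t -> g \in t ->
  orb t0 (ltrans g^-1%g t).
Proof. by move=> _; exact: orb_translate. Qed.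

Lemma pact_invE g a : D g a -> pact_inv alpha g a = alpha g^-1%g a.
Proof.
move=> Da; have [gb _ _ _] := pact_iso alpha g.
rewrite -{1}(pactVK Da) /pact_inv (pinvKV _ (set_bij_inj gb))//.
by rewrite inE; exact: pact_domV.
Qed.

(** The explicit sums of is_average_tideal for b and for alpha_g b have the same
    terms, listed by g^-1 t and by t respectively. *)
Lemma average_pact t g b : tuples n t -> g \in t -> T (ltrans g^-1%g t) b ->
  average (alpha g b) = average b.
Proof.
move=> tn gt Tb; have tn' := tuples_ltrans tn gt; have [t1 _] := tn.
rewrite (averageE (is_average_tideal tn (pact_tideal t1 Tb))).
rewrite (averageE (is_average_tideal tn' Tb)); congr (_ *: _).
have Db : D g^-1%g b by apply: tideal_pdom Tb; exact: (inv_mem_ltrans _ tn).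
transitivity (\sum_(k <- t) alpha (g^-1 * k)^-1%g b).
  apply: eq_big_seq => k kt; rewrite invgM invgK.
  have [|_ ->//] := @pactM _ _ _ alpha k^-1%g g b Db.
  by rewrite invgK; exact: (pact_tideal t1 Tb).
rewrite -(big_map (fun k => (g^-1 * k)%g) xpredT (fun k => alpha k^-1%g b)).
apply: perm_big; apply: uniq_perm; rewrite ?fset_uniq//.
  by rewrite map_inj_uniq ?fset_uniq//; exact: mulgI.
move=> k; apply/mapP/idP => [[h ht ->]|kt]; first by rewrite mem_ltrans.
by rewrite in_ltrans invgK in kt; exists (g * k)%g; rewrite ?mulKg.
Qed.

Section Orbit.
Variables (t : {fset G}) (x : 'I_(mt n t).+1 -> G).
Hypotheses (tn : tuples n t) (hx : coset_reps x).
Local Notation m := (mt n t).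
Local Notation tj := (orbit_tuple x).

Lemma tcomp_orbit_sum (f : 'I_m.+1 -> A) j : (forall i, T (tj i) (f i)) ->
  tcomp (tj j) (\sum_i f i) = f j.
Proof.
move=> Tf; have tjn i := orbit_tuple_tuples tn hx i.
rewrite tcomp_sum// (bigD1 j)//= tcomp_id// big1 ?addr0// => i ij.
apply: tcomp_other (Tf i) => //; apply: contraNneq ij.
by move=> /(orbit_tuple_inj hx) ->.
Qed.

Lemma orbit_sum_supported (f : 'I_m.+1 -> A) : (forall i, T (tj i) (f i)) ->
  supported (orb t) (\sum_i f i).
Proof.
move=> Tf; apply: (ideal_sum (supported_ideal (orb t))) => i _.
by apply: tideal_supported (Tf i); [exact: orbit_tuple_tuples|exact: orbit_tuple_orb].
Qed.

Lemma supported_orbit_sum a : supported (orb t) a -> a = \sum_j tcomp (tj j) a.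
Proof.
have Tt j : T (tj j) (tcomp (tj j) a) by apply: tcomp_in; exact: orbit_tuple_tuples.
move=> Sa; apply: tcomp_ext => s sn.
have [/(orbP hx)[j ->]|ts] := pselect (orb t s); first by rewrite tcomp_orbit_sum.
by rewrite Sa// orbit_sum_supported.
Qed.

Lemma orbit_idealE : orbit_ideal alpha t = supported (orb t).
Proof.
apply/seteqP; split=> a.
  move=> [F [f [Ff ->]]]; apply: (ideal_sum (supported_ideal _)) => g /Ff[gt Tf].
  have ot : orb t (ltrans g t) by exists g.
  by apply: tideal_supported Tf => //; exact: (orb_tuples tn ot).
move=> Sa; exists [fset (x j)^-1%g | j in 'I_m.+1]%fset, (fun g => tcomp (ltrans g t) a).
split=> [g /imfsetP[j _ ->]|].
  split; first by exists (x j) => //; exact: (rep_in hx).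
  by apply: tcomp_in; exact: (orbit_tuple_tuples tn hx).
rewrite {1}(supported_orbit_sum Sa) big_imfset /=; last first.
  by move=> i j _ _ E; apply: (orbit_tuple_inj hx); rewrite /orbit_tuple E.
by rewrite big_enum.
Qed.

Lemma proj_compE j a : supported (orb t) a -> proj_comp alpha x j a = tcomp (tj j) a.
Proof.
move=> Sa; rewrite /proj_comp; case: xgetP => [b _ [f [Tf -> ->]]|].
  by rewrite tcomp_orbit_sum.
move=> /(_ (tcomp (tj j) a)); case; exists (fun i => tcomp (tj i) a); split => //.
  by move=> i; apply: tcomp_in; exact: (orbit_tuple_tuples tn hx).
exact: supported_orbit_sum.
Qed.

(** By sum_reps, phi is the sum of is_average_tideal up to a scalar. *)
Lemma phiE a : T t a -> phi alpha x a = ((lstab_card t)%:R^-1 * n%:R) *: average a.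
Proof.
move=> Ta; rewrite (averageE (is_average_tideal tn Ta)) scalerA -mulrA divff; last first.
  by rewrite pnatr_eq0 -lt0n.
rewrite mulr1 /phi (sum_reps tn hx (fun g => pact_inv alpha g a)); congr (_ *: _).
by apply: eq_big_seq => g gt; rewrite pact_invE//; exact: Ta.
Qed.

(** By average_pact each summand is a multiple of the average of a component,
    and the scalars cancel as n = (m + 1) |H|. *)
Lemma orbit_expectationE a : supported (orb t) a ->
  orbit_expectation alpha x a = average a.
Proof.
move=> Sa; rewrite /orbit_expectation.
have [t1 _] := tn.
have tjn j := orbit_tuple_tuples tn hx j.
have xt j := rep_in hx j.
transitivity ((m.+1%:R^-1 * ((lstab_card t)%:R^-1 * n%:R)) *: \sum_j average (tcomp (tj j) a)).
  rewrite -scalerA; congr (_ *: _); rewrite scaler_sumr; apply: eq_bigr => j _.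
  have Tj : T (tj j) (tcomp (tj j) a) by exact: tcomp_in.
  rewrite proj_compE// phiE; last exact: pact_tideal.
  by rewrite (average_pact tn (xt j) Tj).
rewrite -average_sum -supported_orbit_sum// mulrA -invfM.
have nE : (m.+1%:R * (lstab_card t)%:R = n%:R :> R[i]).
  by rewrite -natrM -(card_reps tn hx).
by rewrite nE mulVf ?scale1r// pnatr_eq0 -lt0n.
Qed.

Lemma orbit_fixedE : orbit_fixed alpha t = supported (orb t) `&` equivariant.
Proof.
rewrite /orbit_fixed orbit_idealE fixed_supportedE//.
by move=> s g sn; exact: orb_invariant.
Qed.

Lemma orbit_fixed_components (h : G) (j k : 'I_m.+1) a :
  lstab t h -> orbit_fixed alpha t a ->
  let g := ((x k)^-1 * h * x j)%g in
  pdom alpha (g^-1)%g (proj_comp alpha x j a) /\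
  proj_comp alpha x k a = alpha g (proj_comp alpha x j a).
Proof.
rewrite orbit_fixedE => ht [Sa Ea] g; rewrite !proj_compE//.
have gk : g \in tj k.
  by rewrite in_ltrans invgK /g -!mulgA mulVKg; exact: (rep_mem hx).
have E : tj j = ltrans g^-1%g (tj k).
  rewrite /orbit_tuple -ltransM /g !invgM invgK mulgA mulgK ltransM.
  by congr ltrans; rewrite (lstabV ht).
rewrite E Ea//; last exact: (orbit_tuple_tuples tn hx).
split=> //; apply: tcomp_translate_pdom => //; exact: (orbit_tuple_tuples tn hx).
Qed.

Lemma phi_fixed a : T t a -> orbit_fixed alpha t (phi alpha x a).
Proof.
move=> Ta; rewrite phiE// -averageZ orbit_fixedE.
split; last exact: average_equivariant.
apply: average_supported; first by move=> s g sn; exact: orb_invariant.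
apply: (idealZ _ (supported_ideal _)).
by apply: tideal_supported Ta => //; exact: (orb_refl tn).
Qed.

Lemma orbit_expectation_faithful :
  faithful_cond_expectation (orbit_ideal alpha t) (orbit_fixed alpha t)
    (orbit_expectation alpha x).
Proof.
have EE a : supported (orb t) a -> orbit_expectation alpha x a = average a.
  exact: orbit_expectationE.
have Sinv : forall s g, tuples n s -> orb t s -> g \in s -> orb t (ltrans g^-1%g s).
  by move=> s g; exact: orb_invariant.
have [[dom cod sub in_ id_ lin pos contr modl modr] faith] :=
  faithful_cond_expectation_average Sinv.
have hS := supported_ideal (orb t).
have SP a : positives (supported (orb t)) a -> supported (orb t) a.
  by move=> [c Sc ->]; exact: ideal_mull hS Sc.
rewrite /orbit_fixed orbit_idealE; split; last first.
  by move=> a pa; rewrite (EE a (SP a pa)); exact: faith.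
split => //.
- by move=> a Sa; rewrite (EE a Sa); exact: in_.
- by move=> b Bb; rewrite (EE b (sub b Bb)); exact: id_.
- move=> k a b Sa Sb; rewrite (EE _ (idealD hS (idealZ k hS Sa) Sb)).
  by rewrite (EE a Sa) (EE b Sb); exact: lin.
- by move=> a pa; rewrite (EE a (SP a pa)); exact: pos.
- by move=> a Sa; rewrite (EE a Sa); exact: contr.
- by move=> b a Bb Sa; rewrite (EE _ (ideal_mull b hS Sa)) (EE a Sa); exact: modl.
- by move=> a b Sa Bb; rewrite (EE _ (ideal_mulr b hS Sa)) (EE a Sa); exact: modr.
Qed.

End Orbit.

(** * The direct sum over all orbits *)
Section DirectSum.
#[local] Existing Instance totally_filter.
Variable x : forall t : {fset G}, 'I_(mt n t).+1 -> G.
Arguments x : clear implicits.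
Hypothesis hx : forall t, tuples n t -> coset_reps (x t).
Variable s : orbit_space (G := G) n -> {fset G}.
Hypothesis hs : orbit_section s.
Implicit Types (z : orbit_space (G := G) n) (f : orbit_space (G := G) n -> A).

Let s_tuples z : tuples n (s z). Proof. by case: (hs z). Qed.

Lemma section_cover t : tuples n t -> exists z, orb (s z) t.
Proof.
move=> tn; have tO : orbit_space n (orb t) by exists t.
exists (exist _ (orb t) (mem_set tO)); have [_ ->] := hs (exist _ (orb t) (mem_set tO)).
exact: (orb_refl tn).
Qed.

Lemma section_uniq z z' t : orb (s z) t -> orb (s z') t -> z = z'.
Proof.
move=> zt zt'; apply: val_inj; have [_ <-] := hs z; have [_ <-] := hs z'.
by rewrite -(orb_eq (s_tuples z) zt) (orb_eq (s_tuples z') zt').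
Qed.

Lemma tcomp_partial_sum f (J : {fset orbit_space (G := G) n}) z t :
  (forall z, supported (orb (s z)) (f z)) -> tuples n t -> orb (s z) t ->
  tcomp t (partial_sum f J) = if z \in J then tcomp t (f z) else 0.
Proof.
move=> Sf tn zt; have E : partial_sum f J = \sum_(y <- J) f y.
  by rewrite /partial_sum big_seq_fsetE.
have other y : y != z -> tcomp t (f y) = 0.
  move=> yz; apply: Sf => // yt; move/eqP: yz; apply; exact: section_uniq yt zt.
rewrite E tcomp_sum//; have [zJ|zJ] := boolP (z \in J).
  by rewrite (bigD1_seq z zJ (fset_uniq J))/= big1 ?addr0.
rewrite big_seq big1// => y yJ; apply: other.
by apply: contraNneq zJ => <-.
Qed.

(** Taking components is continuous, and that of the partial sums is constant as
    soon as z is among the summands. *)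
Lemma c0_decomposition_components f a z t : c0_decomposition alpha s f a ->
  orb (s z) t -> tcomp t (f z) = tcomp t a.
Proof.
move=> [If fa] zt; have tn := orb_tuples (s_tuples z) zt.
have Sf y : supported (orb (s y)) (f y).
  by rewrite -(orbit_idealE (s_tuples y) (hx (s_tuples y))).
apply/eqP; rewrite eq_sym -subr_eq0; apply/eqP/norm_small_eq0 => e e0.
move/cvgrPdist_le : fa => /(_ e e0)[J _ HJ].
have := HJ (z |` J)%fset (fsubsetU1 z J) => /(le_trans (tcomp_norm _ tn)).
by rewrite tcompB// (tcomp_partial_sum _ Sf tn zt) fset1U1.
Qed.

Lemma c0_decomposition_of_components f a :
  (forall z, supported (orb (s z)) (f z)) ->
  (forall z t, orb (s z) t -> tcomp t (f z) = tcomp t a) ->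
  c0_decomposition alpha s f a.
Proof.
move=> Sf Hf; split=> [z|].
  by rewrite (orbit_idealE (s_tuples z) (hx (s_tuples z))).
apply/cvgrPdist_le => e e0; have [F Fn HF] := tcomp_truncation a e0.
have cover (r : seq {fset G}) : (forall t, t \in r -> tuples n t) ->
    exists J : {fset orbit_space (G := G) n},
    forall t, t \in r -> exists2 z, z \in J & orb (s z) t.
  elim: r => [|t r IH] rn; first by exists fset0 => t; rewrite in_nil.
  have [|J HJ] := IH; first by move=> u ur; apply: rn; rewrite inE ur orbT.
  have [z zt] := section_cover (rn t (mem_head _ _)).
  exists (z |` J)%fset => u; rewrite inE => /orP[/eqP ->|/HJ[y yJ yu]].
    by exists z; rewrite ?fset1U1.
  by exists y; rewrite ?fset1Ur.
have [J HJ] := cover (enum_fset F) Fn.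
exists J => // B JB /=; apply: HF => t tn; have [z zt] := section_cover tn.
rewrite (tcomp_partial_sum _ Sf tn zt); case: ifPn => zB; first by left; exact: Hf.
right; split=> //; apply: contraNN zB => /HJ[y yJ yt].
by rewrite (section_uniq zt yt); exact: (fsubsetP JB).
Qed.

Lemma c0_decomposition_uniq f f' a : c0_decomposition alpha s f a ->
  c0_decomposition alpha s f' a -> f = f'.
Proof.
move=> Hf Hf'; apply/funext => z; have tz := s_tuples z.
have Sf : supported (orb (s z)) (f z) by rewrite -(orbit_idealE tz (hx tz)); case: Hf.
have Sf' : supported (orb (s z)) (f' z) by rewrite -(orbit_idealE tz (hx tz)); case: Hf'.
apply: tcomp_ext => t tn; have [zt|zt] := pselect (orb (s z) t); last by rewrite Sf// Sf'.
by rewrite (c0_decomposition_components Hf zt) (c0_decomposition_components Hf' zt).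
Qed.

Lemma c0_decomposition_exists a : exists f, c0_decomposition alpha s f a.
Proof.
pose tj z := orbit_tuple (x (s z)).
have Tt z j : T (tj z j) (tcomp (tj z j) a).
  by apply: tcomp_in; exact: (orbit_tuple_tuples (s_tuples z) (hx (s_tuples z))).
exists (fun z => \sum_j tcomp (tj z j) a); apply: c0_decomposition_of_components => z.
  exact: (orbit_sum_supported (s_tuples z) (hx (s_tuples z)) (Tt z)).
move=> t /(orbP (hx (s_tuples z)))[j ->].
exact: (tcomp_orbit_sum (s_tuples z) (hx (s_tuples z)) j (Tt z)).
Qed.

Lemma c0_compE f a z : c0_decomposition alpha s f a -> c0_comp alpha s z a = f z.
Proof.
move=> Hf; rewrite /c0_comp; case: xgetP => [b _ [f' Hf' ->]|/(_ (f z))].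
  by rewrite (c0_decomposition_uniq Hf Hf').
by case; exists f.
Qed.

Lemma c0_comp_decomposition a :
  c0_decomposition alpha s (fun z => c0_comp alpha s z a) a.
Proof.
have [f Hf] := c0_decomposition_exists a.
suff -> : (fun z => c0_comp alpha s z a) = f by [].
by apply/funext => z; exact: c0_compE.
Qed.

(** Averaging commutes with the decomposition, because avg t involves only
    components in the orbit of t. *)
Lemma global_expectation_cvg a :
  partial_sum (fun z => orbit_expectation alpha (x (s z)) (c0_comp alpha s z a))
    @ totally --> average a.
Proof.
have Hc := c0_comp_decomposition a.
have Sc z : supported (orb (s z)) (c0_comp alpha s z a).
  by rewrite -(orbit_idealE (s_tuples z) (hx (s_tuples z))); case: Hc.
have -> : (fun z => orbit_expectation alpha (x (s z)) (c0_comp alpha s z a)) =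
    (fun z => average (c0_comp alpha s z a)).
  apply/funext => z; exact: (orbit_expectationE (s_tuples z) (hx (s_tuples z)) (Sc z)).
suff [] : c0_decomposition alpha s (fun z => average (c0_comp alpha s z a)) (average a) by [].
apply: c0_decomposition_of_components => [z|z t zt].
  by apply: average_supported (Sc z) => u g un; exact: orb_invariant.
have tn := orb_tuples (s_tuples z) zt.
rewrite !averageP// /avg; congr (_ *: _); apply: eq_big_seq => g gt.
by rewrite (c0_decomposition_components Hc (orb_translate zt gt)).
Qed.

Lemma global_expectationE a : global_expectation alpha x s a = average a.
Proof. by apply: norm_cvg_lim; exact: global_expectation_cvg. Qed.

End DirectSum.

Lemma supportedT : supported (tuples n) = setT.
Proof. by apply/seteqP; split => // a _ t tn; case. Qed.

Lemma global_average_faithful :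
  faithful_cond_expectation setT (fixed_algebra alpha setT) average.
Proof.
rewrite -supportedT; apply: faithful_cond_expectation_average => t g tn _.
exact: tuples_ltrans.
Qed.

End Components.

Unset Implicit Arguments.

Theorem theorem4p4 (R : realType) (G : groupType) (A : cstarAlgType R)
    (n : nat) (alpha : partialAction G A)
    (x : forall t : {fset G}, 'I_(mt n t).+1 -> G) :
  (0 < n)%N ->
  decomposition_property alpha n ->
  (forall t, tuples n t -> coset_reps (x t)) ->
  (forall t : {fset G}, tuples n t ->
    [/\ (* (1) *)
        forall (h : G) (j k : 'I_(mt n t).+1) (a : A),
          lstab t h -> orbit_fixed alpha t a ->
          let g := ((x t k)^-1 * h * x t j)%g in
          pdom alpha (g^-1)%g (proj_comp alpha (x t) j a) /\
          proj_comp alpha (x t) k a = alpha g (proj_comp alpha (x t) j a),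
        (* (2) *)
        forall a : A, tideal alpha t a ->
          orbit_fixed alpha t (phi alpha (x t) a),
        (* (3) *)
        faithful_cond_expectation (orbit_ideal alpha t) (orbit_fixed alpha t)
          (orbit_expectation alpha (x t)),
        (* (4) *)
        forall y : 'I_(mt n t).+1 -> G, coset_reps y ->
          forall a : A, orbit_ideal alpha t a ->
          orbit_expectation alpha y a = orbit_expectation alpha (x t) a &
        (* (5) *)
        forall g : G, invset t g ->
          orbit_ideal alpha (ltrans g t) = orbit_ideal alpha t /\
          forall a : A, orbit_ideal alpha t a ->
            orbit_expectation alpha (x (ltrans g t)) a =
            orbit_expectation alpha (x t) a]) /\
  (forall s : orbit_space n -> {fset G}, orbit_section s ->
     (* E is well defined *)
     (forall a : A,
        c0_decomposition alpha s (fun z => c0_comp alpha s z a) a /\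
        partial_sum (fun z => orbit_expectation alpha (x (s z))
                                (c0_comp alpha s z a)) @ totally
          --> global_expectation alpha x s a) /\
     faithful_cond_expectation setT (fixed_algebra alpha setT)
       (global_expectation alpha x s)) /\
  (forall s s' : orbit_space n -> {fset G},
     orbit_section s -> orbit_section s' ->
     forall a : A,
       global_expectation alpha x s a = global_expectation alpha x s' a).
Proof.
move=> n_gt0 dec hx.
have hE s (hs : orbit_section s) a : global_expectation alpha x s a = average alpha n a.
  exact: global_expectationE.
split=> [t tn|].
  split.
  - by move=> h j k a; exact: (orbit_fixed_components dec tn (hx t tn)).
  - by move=> a; exact: (phi_fixed dec n_gt0 tn (hx t tn)).
  - exact: (orbit_expectation_faithful dec n_gt0 tn (hx t tn)).
  - move=> y hy a; rewrite (orbit_idealE dec tn (hx t tn)) => Sa.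
    rewrite (orbit_expectationE dec n_gt0 tn hy Sa).
    by rewrite (orbit_expectationE dec n_gt0 tn (hx t tn) Sa).
  - move=> g tg; have ot : orb t (ltrans g t) by exists g.
    have tn' := orb_tuples tn ot.
    rewrite (orbit_idealE dec tn (hx t tn)) (orbit_idealE dec tn' (hx _ tn')).
    rewrite (orb_eq tn ot); split=> // a Sa.
    rewrite (orbit_expectationE dec n_gt0 tn (hx t tn) Sa).
    by apply: (orbit_expectationE dec n_gt0 tn' (hx _ tn')); rewrite (orb_eq tn ot).
split=> [s hs|s s' hs hs' a]; last by rewrite !hE.
split=> [a|].
  split; first exact: (c0_comp_decomposition dec hx hs).
  by rewrite hE//; exact: (global_expectation_cvg dec n_gt0 hx hs).
have -> : global_expectation alpha x s = average alpha n by apply/funext => a; exact: hE.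
exact: (global_average_faithful dec n_gt0).
Qed.
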